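(* Let $H$ be a Hopf algebra over a field $K$ and let $\mathcal{M}$ denote either ${}^{H}\mathfrak{M}^{H}$ or $\mathfrak{M}^{H}$. Let $A$ be an algebra in $\mathcal{M}$ and consider the forgetful functors $\mathbb{H}:{}_{A}\mathcal{M}_{A}\to\mathcal{M}$, $\mathbb{H}':{}_{A}\mathfrak{M}_{A}\to\mathfrak{M}_{K}$ and $F:{}_{A}\mathcal{M}_{A}\to{}_{A}\mathfrak{M}_{A}$. Then, for $P\in{}_{A}\mathcal{M}_{A}$: if $P$ is $\mathcal{E}_{\mathbb{H}}$-projective, then $P$ is $\mathcal{E}_{\mathbb{H}'}$-projective as an object in ${}_{A}\mathfrak{M}_{A}$; the converse is true whenever $F$ is separable. In particular: (i) If $A$ is separable as an algebra in $\mathcal{M}$, then $A$ is separable as an algebra in $\mathfrak{M}_{K}$; the converse is true whenever $F$ is separable. (ii) If $A$ is formally smooth as an algebra in $\mathcal{M}$, then $A$ is formally smooth as an algebra in $\mathfrak{M}_{K}$; the converse is true whenever $F$ is separable.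
   Context: $\mathfrak{M}^H$ (resp. ${}^H\mathfrak{M}^H$) is the monoidal category of right $H$-comodules (resp. $H$-bicomodules), with $\otimes_K$ carrying codiagonal coaction(s) and unit $K$; $\mathfrak{M}_K$ is the monoidal category of $K$-vector spaces. For an algebra $A$ in a monoidal category $\mathcal{M}$, ${}_A\mathcal{M}_A$ is the category of $A$-bimodules in $\mathcal{M}$; ${}_A\mathfrak{M}_A$ is the category of ordinary $A$-bimodules. For a functor $G:\mathfrak{B}\to\mathfrak{A}$, $\mathcal{E}_G$ is the class of morphisms $f$ of $\mathfrak{B}$ such that $G(f)$ has a section (right inverse) in $\mathfrak{A}$. An object $P$ of $\mathfrak{B}$ is $\mathcal{E}_G$-projective if for every $f:X\to Y$ in $\mathcal{E}_G$ every morphism $P\to Y$ factors through $f$. An algebra $(A,m,u)$ in $\mathcal{M}$ is separable in $\mathcal{M}$ if $m$ has a section $A\to A\otimes A$ in ${}_A\mathcal{M}_A$; it is formally smooth in an abelian monoidal category $\mathcal{M}$ if $\Omega^1A=\ker m\in{}_A\mathcal{M}_A$ is $\mathcal{E}_{G}$-projective for the forgetful functor $G:{}_A\mathcal{M}_A\to\mathcal{M}$. Separable functor: a functor $U:\mathfrak{B}\to\mathfrak{A}$ such that the natural transformation $\mathrm{Hom}_{\mathfrak B}(\bullet,\bullet)\to \mathrm{Hom}_{\mathfrak A}(U(\bullet),U(\bullet))$, $f\mapsto U(f)$, of functors $\mathfrak{B}^{op}\times\mathfrak{B}\to\mathfrak{Sets}$ has a left inverse natural transformation. *)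

(* Defs.v *)
From HB Require Import structures.
From mathcomp Require Import all_boot all_algebra.
From mathcomp Require Import generic_quotient boolp.

Set Implicit Arguments.
Unset Strict Implicit.
Unset Printing Implicit Defensive.

Import GRing.Theory.
Local Open Scope ring_scope.
Local Open Scope quotient_scope.

Section LinearMaps.
Variable K : fieldType.

Lemma linear_ext (V W : lmodType K) (f g : {linear V -> W}) : f =1 g -> f = g.
Proof.
case: f g => [f [[fA] [fZ]]] [g [[gA] [gZ]]] /= /funext fg.
move: fA fZ gA gZ; rewrite {}fg => fA fZ gA gZ.
by rewrite (Prop_irrelevance fA gA) (Prop_irrelevance fZ gZ).
Qed.

Definition mk_linear (V W : lmodType K) (f : V -> W) (hf : linear f) :
    {linear V -> W} :=
  HB.pack f (GRing.isLinear.Build K V W *:%R f hf).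

Definition bilin (V W U : lmodType K) (f : V -> W -> U) : Prop :=
  (forall v, linear (f v)) /\ (forall w, linear (fun v => f v w)).

Variables V W : lmodType K.

(* The tensor product of two (arbitrary) K-vector spaces.  Its elements are the
   finite formal sums of pairs (v, w), represented by sequences, two of them
   being identified when every bilinear map takes the same value on both.  It
   therefore has the universal property of the tensor product: see [liftE] and
   [tensor_ext] below. *)
Definition tensor_eval (U : lmodType K) (f : V -> W -> U) (s : seq (V * W)) : U :=
  \sum_(p <- s) f p.1 p.2.

Definition tensor_rel (s t : seq (V * W)) : bool :=
  `[< forall (U : lmodType K) (f : V -> W -> U), bilin f ->
        tensor_eval f s = tensor_eval f t >].

Lemma tensor_rel_equiv : equiv_class_of tensor_rel.
Proof.
split=> [s|s t|t s r].
- exact/asboolP.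
- by apply/asboolP/asboolP => h U f hf; rewrite h.
- by move=> /asboolP h1 /asboolP h2; apply/asboolP => U f hf; rewrite h1 ?h2.
Qed.

Definition tensor_equiv := EquivRelPack tensor_rel_equiv.

Definition tensor : Type := {eq_quot tensor_equiv}%qT.
HB.instance Definition _ := Choice.on tensor.

Definition tclass (s : seq (V * W)) : tensor := \pi_({eq_quot tensor_equiv}%qT) s.
Definition trep (x : tensor) : seq (V * W) := repr (x : {eq_quot tensor_equiv}%qT).

Lemma tclass_eq s t :
  (forall (U : lmodType K) (f : V -> W -> U), bilin f ->
     tensor_eval f s = tensor_eval f t) -> tclass s = tclass t.
Proof. by move=> h; rewrite /tclass; apply/eqmodP/asboolP. Qed.

Lemma trepK x : tclass (trep x) = x. Proof. exact: reprK. Qed.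

Lemma eval_trep s (U : lmodType K) (f : V -> W -> U) :
  bilin f -> tensor_eval f (trep (tclass s)) = tensor_eval f s.
Proof.
move=> hf; have : tensor_rel (trep (tclass s)) s by rewrite -[tensor_rel _ _]/(tensor_equiv _ _); apply/eqmodP; exact: trepK.
by move/asboolP; apply.
Qed.

Definition tadd x y := tclass (trep x ++ trep y).
Definition tscale (a : K) x := tclass [seq (a *: p.1, p.2) | p <- trep x].
Definition tzero := tclass [::].
Definition topp := tscale (- 1).

Lemma evalD s t (U : lmodType K) (f : V -> W -> U) :
  tensor_eval f (s ++ t) = tensor_eval f s + tensor_eval f t.
Proof. exact: big_cat. Qed.

Lemma eval0 (U : lmodType K) (f : V -> W -> U) : tensor_eval f [::] = 0.
Proof. exact: big_nil. Qed.

Lemma linearZ0 (U U' : lmodType K) (f : U -> U') a u : linear f -> f (a *: u) = a *: f u.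
Proof. by move=> hf; exact: (scalable_linear hf). Qed.

Lemma evalZ a s (U : lmodType K) (f : V -> W -> U) : bilin f ->
  tensor_eval f [seq (a *: p.1, p.2) | p <- s] = a *: tensor_eval f s.
Proof.
move=> [_ hf]; rewrite /tensor_eval big_map scaler_sumr.
by apply: eq_bigr => p _ /=; rewrite (linearZ0 a p.1 (hf p.2)).
Qed.

Local Ltac tsolve := rewrite /topp /tadd /tzero /tscale;
  apply: tclass_eq => ? ? ?;
  do ?[rewrite evalD | rewrite eval0 | rewrite evalZ // | rewrite eval_trep //].

Fact taddA : associative tadd.
Proof. by move=> x y z; tsolve; rewrite addrA. Qed.
Fact taddC : commutative tadd.
Proof. by move=> x y; tsolve; rewrite addrC. Qed.
Fact tadd0 : left_id tzero tadd.
Proof. by move=> x; rewrite -[RHS]trepK; tsolve; rewrite add0r. Qed.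
Fact taddN : left_inverse tzero topp tadd.
Proof. by move=> x; tsolve; rewrite scaleN1r addNr. Qed.

HB.instance Definition _ := GRing.isZmodule.Build tensor taddA taddC tadd0 taddN.

Fact tscaleA a b x : tscale a (tscale b x) = tscale (a * b) x.
Proof. by tsolve; rewrite scalerA. Qed.
Fact tscale1 : left_id 1 tscale.
Proof. by move=> x; rewrite -[RHS]trepK; tsolve; rewrite scale1r. Qed.
Fact tscaleDr : right_distributive tscale +%R.
Proof. by move=> a x y; rewrite /GRing.add/=; tsolve; rewrite scalerDr. Qed.
Fact tscaleDl x : {morph tscale^~ x : a b / a + b}.
Proof. by move=> a b; rewrite {2}/GRing.add/=; tsolve; rewrite scalerDl. Qed.

HB.instance Definition _ :=
  GRing.Zmodule_isLmodule.Build K tensor tscaleA tscale1 tscaleDr tscaleDl.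

End LinearMaps.

Section TensorTheory.
Variable K : fieldType.
Implicit Types V W U X : lmodType K.

Definition pure V W (v : V) (w : W) : tensor V W := tclass [:: (v, w)].

Lemma tensor_eval1 V W U (f : V -> W -> U) v w :
  tensor_eval f [:: (v, w)] = f v w.
Proof. exact: big_seq1. Qed.

Lemma pure_bilin V W : bilin (@pure V W).
Proof.
by split=> z a x y; apply: tclass_eq => U f hf;
   rewrite evalD eval_trep // evalZ // !eval_trep // !tensor_eval1;
   case: hf => hl hr; rewrite ?(hl, hr).
Qed.

Lemma pureDl V W (v v' : V) (w : W) : pure (v + v') w = pure v w + pure v' w.
Proof. by have := (pure_bilin V W).2 w 1 v v'; rewrite !scale1r. Qed.
Lemma pureDr V W (v : V) (w w' : W) : pure v (w + w') = pure v w + pure v w'.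
Proof. by have := (pure_bilin V W).1 v 1 w w'; rewrite !scale1r. Qed.
Lemma pureZl V W a (v : V) (w : W) : pure (a *: v) w = a *: pure v w.
Proof. exact: (linearZ0 a v ((pure_bilin V W).2 w)). Qed.
Lemma pureZr V W a (v : V) (w : W) : pure v (a *: w) = a *: pure v w.
Proof. exact: (linearZ0 a w ((pure_bilin V W).1 v)). Qed.

Lemma tensor_ind V W (P : tensor V W -> Prop) :
  (forall v w, P (pure v w)) -> (forall x y, P x -> P y -> P (x + y)) ->
  forall x, P x.
Proof.
move=> P1 PD x; rewrite -(trepK x); elim: (trep x) => [|[v w] s IH].
- suff -> : tclass [::] = pure (0 : V) (0 : W) by exact: P1.
  by rewrite -[X in pure X _](scale0r (0 : V)) pureZl scale0r.
- suff -> : tclass ((v, w) :: s) = pure v w + tclass s by exact: PD.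
  apply: tclass_eq => U f hf; rewrite evalD !eval_trep // tensor_eval1.
  exact: big_cons.
Qed.

Definition lift_fun V W U (f : V -> W -> U) (x : tensor V W) : U :=
  tensor_eval f (trep x).

Lemma lift_linear V W U (f : V -> W -> U) : bilin f -> linear (lift_fun f).
Proof.
by move=> hf a x y; rewrite /lift_fun eval_trep // evalD eval_trep // evalZ.
Qed.

End TensorTheory.

HB.lock Definition lift (K : fieldType) (V W U : lmodType K) (f : V -> W -> U)
    (hf : bilin f) : {linear tensor V W -> U} := mk_linear (lift_linear hf).

Section TensorMaps.
Variable K : fieldType.
Implicit Types V W U X : lmodType K.

Lemma liftE V W U (f : V -> W -> U) (hf : bilin f) v w :
  lift hf (pure v w) = f v w.
Proof. by rewrite lift.unlock /= /lift_fun eval_trep // tensor_eval1. Qed.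

Lemma tensor_ext V W U (f g : {linear tensor V W -> U}) :
  (forall v w, f (pure v w) = g (pure v w)) -> f = g.
Proof.
move=> fg; apply: linear_ext; elim/tensor_ind => // x y hx hy.
by rewrite !linearD hx hy.
Qed.

Lemma tensor_ext3 V W X U
    (f g : {linear tensor (tensor V W) X -> U}) :
  (forall v w x, f (pure (pure v w) x) = g (pure (pure v w) x)) -> f = g.
Proof.
move=> fg; apply: tensor_ext => + x; elim/tensor_ind => // s t hs ht.
by rewrite pureDl !linearD hs ht.
Qed.

Lemma tensor_ext3' V W X U
    (f g : {linear tensor V (tensor W X) -> U}) :
  (forall v w x, f (pure v (pure w x)) = g (pure v (pure w x))) -> f = g.
Proof.
move=> fg; apply: tensor_ext => v; elim/tensor_ind => // s t hs ht.
by rewrite pureDr !linearD hs ht.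
Qed.

Lemma tensor_ext4 V W X U Y
    (f g : {linear tensor (tensor (tensor V W) X) Y -> U}) :
  (forall v w x y, f (pure (pure (pure v w) x) y) =
                   g (pure (pure (pure v w) x) y)) -> f = g.
Proof.
move=> fg; apply: tensor_ext3 => + x y; elim/tensor_ind => // s t hs ht.
by rewrite !pureDl !linearD hs ht.
Qed.

Lemma tensor_ext22 V W X Y U
    (f g : {linear tensor (tensor V W) (tensor X Y) -> U}) :
  (forall v w x y, f (pure (pure v w) (pure x y)) = g (pure (pure v w) (pure x y))) ->
  f = g.
Proof.
move=> fg; apply: tensor_ext => + y; elim/tensor_ind => [v w|s t hs ht].
  by elim/tensor_ind: y => // s t hs ht; rewrite pureDr !linearD hs ht.
by rewrite pureDl !linearD hs ht.
Qed.

Lemma lift_param V W U X (f : X -> V -> W -> U) (hf : forall x, bilin (f x)) :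
  (forall v w, linear (fun x => f x v w)) ->
  forall t, linear (fun x => lift (hf x) t).
Proof.
move=> hX t a x y; elim/tensor_ind: t => [v w|s t hs ht].
- by rewrite !liftE hX.
- by rewrite !linearD hs ht addrACA.
Qed.

Fact tmap_bilin V V' W W' (f : {linear V -> V'}) (g : {linear W -> W'}) :
  bilin (fun v w => pure (f v) (g w)).
Proof.
by split=> z a x y; rewrite linearP ?(pureDl, pureDr) ?(pureZl, pureZr).
Qed.

Definition tmap V V' W W' (f : {linear V -> V'}) (g : {linear W -> W'}) :
  {linear tensor V W -> tensor V' W'} := lift (tmap_bilin f g).

Lemma tmapE V V' W W' (f : {linear V -> V'}) (g : {linear W -> W'}) v w :
  tmap f g (pure v w) = pure (f v) (g w).
Proof. exact: liftE. Qed.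

Fact tassoc_bilin0 V W X (x : X) :
  bilin (fun (v : V) (w : W) => pure v (pure w x)).
Proof.
by split=> z a u u'; rewrite ?(pureDl, pureDr) ?(pureZl, pureZr) // pureDr pureZr.
Qed.

Fact tassoc_bilin V W X : bilin (fun t (x : X) => lift (tassoc_bilin0 V W x) t).
Proof.
split=> [t|x]; last exact: linearP.
apply: lift_param => v w a x y.
by rewrite !(pureDr, pureZr).
Qed.

Definition tassoc V W X :
  {linear tensor (tensor V W) X -> tensor V (tensor W X)} :=
  lift (tassoc_bilin V W X).

Lemma tassocE V W X (v : V) (w : W) (x : X) :
  tassoc V W X (pure (pure v w) x) = pure v (pure w x).
Proof. by rewrite !liftE. Qed.

Fact tassocV_bilin0 V W X (v : V) :
  bilin (fun (w : W) (x : X) => pure (pure v w) x).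
Proof. by split=> z a u u'; rewrite !(pureDl, pureDr, pureZl, pureZr). Qed.

Fact tassocV_bilin V W X : bilin (fun (v : V) t => lift (tassocV_bilin0 W X v) t).
Proof.
split=> [v|t]; first exact: linearP.
by apply: lift_param => w x a v v'; rewrite !(pureDl, pureZl).
Qed.

Definition tassocV V W X :
  {linear tensor V (tensor W X) -> tensor (tensor V W) X} :=
  lift (tassocV_bilin V W X).

Lemma tassocVE V W X (v : V) (w : W) (x : X) :
  tassocV V W X (pure v (pure w x)) = pure (pure v w) x.
Proof. by rewrite !liftE. Qed.

Fact tlunit_bilin V : bilin (fun (k : K^o) (v : V) => k *: v).
Proof.
split=> z a x y; first by rewrite scalerDr !scalerA mulrC.
by rewrite scalerDl -scalerA.
Qed.
Definition tlunit V : {linear tensor K^o V -> V} := lift (tlunit_bilin V).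
Lemma tlunitE V k (v : V) : tlunit V (pure k v) = k *: v.
Proof. exact: liftE. Qed.

Definition tlunitV V : {linear V -> tensor K^o V} :=
  mk_linear ((pure_bilin K^o V).1 1).

Fact trunit_bilin V : bilin (fun (v : V) (k : K^o) => k *: v).
Proof. by have [h1 h2] := tlunit_bilin V; split. Qed.
Definition trunit V : {linear tensor V K^o -> V} := lift (trunit_bilin V).
Lemma trunitE V k (v : V) : trunit V (pure v k) = k *: v.
Proof. exact: liftE. Qed.

Definition trunitV V : {linear V -> tensor V K^o} :=
  mk_linear ((pure_bilin V K^o).2 1).

Fact tswap_bilin0 V W X U (v : V) (w : W) :
  bilin (fun (x : X) (u : U) => pure (pure v x) (pure w u)).
Proof. by split=> z a t t'; rewrite !(pureDl, pureDr, pureZl, pureZr). Qed.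

Fact tswap_bilin1 V W X U t :
  bilin (fun (v : V) (w : W) => lift (tswap_bilin0 X U v w) t).
Proof.
by split=> z; apply: lift_param => x u a w w';
   rewrite !(pureDl, pureDr, pureZl, pureZr).
Qed.

Fact tswap_bilin V W X U : bilin (fun s t => lift (@tswap_bilin1 V W X U t) s).
Proof.
split=> [s|t]; last exact: linearP.
by apply: lift_param => v w; exact: linearP.
Qed.

(* (v (x) w) (x) (x (x) u) |-> (v (x) x) (x) (w (x) u) *)
Definition tswap V W X U :
  {linear tensor (tensor V W) (tensor X U) -> tensor (tensor V X) (tensor W U)} :=
  lift (tswap_bilin V W X U).

Lemma tswapE V W X U (v : V) (w : W) (x : X) (u : U) :
  tswap V W X U (pure (pure v w) (pure x u)) = pure (pure v x) (pure w u).
Proof. by rewrite !liftE. Qed.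

End TensorMaps.

Declare Scope cat_scope.
Delimit Scope cat_scope with cat.
Reserved Notation "f \after g" (at level 50, left associativity).
Reserved Notation "X \ox Y" (at level 40, left associativity).
Reserved Notation "f \om g" (at level 40, left associativity).

Record category := Category {
  obj :> Type;
  hom : obj -> obj -> Type;
  idm : forall X, hom X X;
  after : forall X Y Z, hom Y Z -> hom X Y -> hom X Z;
  idmL : forall X Y (f : hom X Y), after (idm Y) f = f;
  idmR : forall X Y (f : hom X Y), after f (idm X) = f;
  afterA : forall X Y Z T (f : hom Z T) (g : hom Y Z) (h : hom X Y),
    after f (after g h) = after (after f g) h
}.
Arguments hom {_} _ _.
Arguments idm {_} _.
Arguments after {_ _ _ _} _ _.
Notation "f \after g" := (after f g) : cat_scope.
Local Open Scope cat_scope.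

Record functor (B A : category) := Functor {
  fobj :> B -> A;
  fmor : forall X Y : B, hom X Y -> hom (fobj X) (fobj Y);
  fmor1 : forall X, fmor (idm X) = idm (fobj X);
  fmorM : forall X Y Z (f : hom Y Z) (g : hom X Y),
    fmor (f \after g) = fmor f \after fmor g
}.
Arguments fmor {_ _} _ {_ _} _.

Definition has_section (C : category) (X Y : C) (f : hom X Y) : Prop :=
  exists s : hom Y X, f \after s = idm Y.

(* The class of the morphisms f of B such that G(f) has a section in A. *)
Definition E_class (B A : category) (G : functor B A) (X Y : B) (f : hom X Y) :
  Prop := has_section (fmor G f).

Definition E_projective (B A : category) (G : functor B A) (P : B) : Prop :=
  forall (X Y : B) (f : hom X Y), E_class G f ->
  forall g : hom P Y, exists h : hom P X, f \after h = g.

(* [T] is a natural left inverse of f |-> U(f), seen as a transformation between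
   the functors Hom(-,-) and Hom(U(-),U(-)) from B^op x B to sets. *)
Definition separable_functor (B A : category) (U : functor B A) : Prop :=
  exists T : forall X Y : B, hom (U X) (U Y) -> hom X Y,
    (forall (X X' Y Y' : B) (f : hom X' X) (g : hom Y Y') (h : hom (U X) (U Y)),
       T X' Y' (fmor U g \after h \after fmor U f) = g \after T X Y h \after f)
    /\ (forall (X Y : B) (f : hom X Y), T X Y (fmor U f) = f).

Definition is_zero_obj (C : category) (Z : C) : Prop :=
  (forall X : C, exists! f : hom X Z, True) /\
  (forall X : C, exists! f : hom Z X, True).

(* In a category with a zero object, the zero morphism from X to Y is the
   one that factors through it. *)
Definition is_zero_mor (C : category) (X Y : C) (f : hom X Y) : Prop :=
  exists (Z : C) (g : hom Z Y) (h : hom X Z), is_zero_obj Z /\ f = g \after h.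

Definition is_kernel (C : category) (X Y : C) (f : hom X Y)
    (N : C) (i : hom N X) : Prop :=
  is_zero_mor (f \after i) /\
  forall (T : C) (t : hom T X), is_zero_mor (f \after t) ->
    exists! s : hom T N, i \after s = t.

Record monoidal_category := MonoidalCategory {
  mcat :> category;
  ox : mcat -> mcat -> mcat;
  om : forall X X' Y Y' : mcat,
    hom X X' -> hom Y Y' -> hom (ox X Y) (ox X' Y');
  munit : mcat;
  assoc : forall X Y Z, hom (ox (ox X Y) Z) (ox X (ox Y Z));
  assocV : forall X Y Z, hom (ox X (ox Y Z)) (ox (ox X Y) Z);
  lunit : forall X, hom (ox munit X) X;
  lunitV : forall X, hom X (ox munit X);
  runit : forall X, hom (ox X munit) X;
  runitV : forall X, hom X (ox X munit);
  om1 : forall X Y, om (idm X) (idm Y) = idm (ox X Y);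
  omM : forall X X' X'' Y Y' Y'' (f' : hom X' X'') (f : hom X X')
      (g' : hom Y' Y'') (g : hom Y Y'),
    om (f' \after f) (g' \after g) = om f' g' \after om f g;
  assocK : forall X Y Z, assocV X Y Z \after assoc X Y Z = idm _;
  assocVK : forall X Y Z, assoc X Y Z \after assocV X Y Z = idm _;
  lunitK : forall X, lunitV X \after lunit X = idm _;
  lunitVK : forall X, lunit X \after lunitV X = idm _;
  runitK : forall X, runitV X \after runit X = idm _;
  runitVK : forall X, runit X \after runitV X = idm _;
  assoc_nat : forall X X' Y Y' Z Z' (f : hom X X') (g : hom Y Y') (h : hom Z Z'),
    assoc X' Y' Z' \after om (om f g) h = om f (om g h) \after assoc X Y Z;
  lunit_nat : forall X Y (f : hom X Y),
    lunit Y \after om (idm munit) f = f \after lunit X;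
  runit_nat : forall X Y (f : hom X Y),
    runit Y \after om f (idm munit) = f \after runit X;
  pentagon : forall X Y Z T,
    assoc X Y (ox Z T) \after assoc (ox X Y) Z T =
    om (idm X) (assoc Y Z T) \after assoc X (ox Y Z) T
      \after om (assoc X Y Z) (idm T);
  triangle : forall X Y,
    om (idm X) (lunit Y) \after assoc X munit Y = om (runit X) (idm Y)
}.
Arguments om {_ _ _ _ _} _ _.
Arguments munit {_}.
Notation "X \ox Y" := (ox X Y) : cat_scope.
Notation "f \om g" := (om f g) : cat_scope.
Notation "1" := (idm _) : cat_scope.

Section MonoidalTheory.
Variable M : monoidal_category.
Implicit Types X Y Z T : M.

Lemma om_split X X' Y Y' (f : hom X X') (g : hom Y Y') :
  f \om g = (f \om 1) \after (1 \om g).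
Proof. by rewrite -omM idmL idmR. Qed.
Lemma om_split' X X' Y Y' (f : hom X X') (g : hom Y Y') :
  f \om g = (1 \om g) \after (f \om 1).
Proof. by rewrite -omM idmL idmR. Qed.
Lemma omMl X X' X'' Y (f' : hom X' X'') (f : hom X X') :
  (f' \after f) \om idm Y = (f' \om 1) \after (f \om 1).
Proof. by rewrite -omM idmL. Qed.
Lemma omMr X X' X'' Y (f' : hom X' X'') (f : hom X X') :
  idm Y \om (f' \after f) = (1 \om f') \after (1 \om f).
Proof. by rewrite -omM idmL. Qed.

Lemma assocV_nat X X' Y Y' Z Z' (f : hom X X') (g : hom Y Y') (h : hom Z Z') :
  assocV X' Y' Z' \after (f \om (g \om h)) = ((f \om g) \om h) \after assocV X Y Z.
Proof.
rewrite -[LHS]idmR -(assocVK X Y Z) -!afterA [_ \after (assoc _ _ _ \after _)]afterA.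
by rewrite -assoc_nat !afterA assocK idmL.
Qed.

Lemma om1_inj X Y (f g : hom X Y) : idm munit \om f = idm munit \om g -> f = g.
Proof.
move=> fg; rewrite -[f]idmR -[g]idmR -(lunitVK X) !afterA.
by rewrite -!lunit_nat fg.
Qed.
Lemma omr1_inj X Y (f g : hom X Y) : f \om idm munit = g \om idm munit -> f = g.
Proof.
move=> fg; rewrite -[f]idmR -[g]idmR -(runitVK X) !afterA.
by rewrite -!runit_nat fg.
Qed.

Lemma epi_cancel X Y Z (f g : hom Y Z) (e : hom X Y) :
  has_section e -> f \after e = g \after e -> f = g.
Proof.
by case=> s es fg; rewrite -[f]idmR -[g]idmR -es !afterA fg.
Qed.

Lemma lunit_ox X Y : lunit (X \ox Y) \after assoc munit X Y = lunit X \om 1.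
Proof.
apply: om1_inj; rewrite omMr.
apply: (@epi_cancel _ _ _ _ _ (assoc munit (munit \ox X) Y \after (assoc munit munit X \om 1))).
  exists ((assocV munit munit X \om 1) \after assocV munit (munit \ox X) Y).
  rewrite afterA -(afterA (assoc _ _ _)) -omMl assocVK om1 idmR.
  exact: assocVK.
rewrite -!afterA (afterA (_ \om assoc _ _ _)) -pentagon !afterA triangle.
rewrite -om1 -assoc_nat -triangle omMl afterA.
by rewrite -assoc_nat.
Qed.

Lemma runit_ox X Y : (1 \om runit Y) \after assoc X Y munit = runit (X \ox Y).
Proof.
apply: omr1_inj; rewrite omMl.
rewrite -[LHS]idmL -[RHS]idmL -(assocK X Y munit) -!afterA; congr (_ \after _).
rewrite afterA assoc_nat -[runit Y \om 1]triangle omMr.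
rewrite -!afterA (afterA (_ \om assoc _ _ _)) -pentagon.
by rewrite -triangle -om1 !afterA assoc_nat.
Qed.

Lemma pentagonV X Y Z T :
  (assoc X Y Z \om 1) \after assocV (X \ox Y) Z T =
  assocV X (Y \ox Z) T \after (1 \om assocV Y Z T) \after assoc X Y (Z \ox T).
Proof.
apply: (@epi_cancel _ _ _ _ _ (assoc (X \ox Y) Z T)).
  by exists (assocV (X \ox Y) Z T); exact: assocVK.
rewrite -!afterA assocK idmR pentagon.
rewrite -(afterA _ _ (assoc X Y Z \om 1)) (afterA (1 \om assocV _ _ _)).
by rewrite -omMr assocK om1 idmL afterA assocK idmL.
Qed.

Lemma pentagonV' X Y Z T :
  assoc (X \ox Y) Z T \after (assocV X Y Z \om 1) =
  assocV X Y (Z \ox T) \after (1 \om assoc Y Z T) \after assoc X (Y \ox Z) T.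
Proof.
apply: (@epi_cancel _ _ _ _ _ (assoc X Y Z \om idm T)).
  by exists (assocV X Y Z \om 1); rewrite -omMl assocVK om1.
rewrite -afterA -omMl assocK om1 idmR -!afterA (afterA (1 \om _)) -pentagon.
by rewrite afterA assocK idmL.
Qed.
End MonoidalTheory.

Record algebra (M : monoidal_category) := MkAlgebra {
  acar :> M;
  amul : hom (acar \ox acar) acar;
  aone : hom munit acar;
  amulA : amul \after (amul \om 1) = amul \after (1 \om amul) \after assoc _ _ _;
  amul1l : amul \after (aone \om 1) = lunit acar;
  amulr1 : amul \after (1 \om aone) = runit acar
}.
Arguments amul {_ _}.
Arguments aone {_ _}.

Section Bimodules.
Variables (M : monoidal_category) (A : algebra M).

Record bimodule := Bimodule {
  bcar :> M;
  lact : hom (A \ox bcar) bcar;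
  ract : hom (bcar \ox A) bcar;
  lactA : lact \after (amul \om 1) = lact \after (1 \om lact) \after assoc _ _ _;
  lact1 : lact \after (aone \om 1) = lunit bcar;
  ractA : ract \after (ract \om 1) = ract \after (1 \om amul) \after assoc _ _ _;
  ract1 : ract \after (1 \om aone) = runit bcar;
  lractA : ract \after (lact \om 1) = lact \after (1 \om ract) \after assoc _ _ _
}.

Record bimod_hom (X Y : bimodule) := BimodHom {
  bmor :> hom (bcar X) (bcar Y);
  bmor_l : bmor \after lact X = lact Y \after (1 \om bmor);
  bmor_r : bmor \after ract X = ract Y \after (bmor \om 1)
}.

Lemma bimod_hom_eq X Y (f g : bimod_hom X Y) : bmor f = bmor g -> f = g.
Proof.
case: f g => [f fl fr] [g gl gr] /= fg; move: fl fr gl gr; rewrite fg.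
by move=> *; congr BimodHom; exact: Prop_irrelevance.
Qed.

Definition bimod_id X : bimod_hom X X.
Proof.
by exists (idm (bcar X)); rewrite idmL om1 idmR.
Defined.

Definition bimod_after X Y Z (f : bimod_hom Y Z) (g : bimod_hom X Y) :
  bimod_hom X Z.
Proof.
exists (bmor f \after bmor g).
- by rewrite -afterA bmor_l afterA bmor_l -afterA omMr.
- by rewrite -afterA bmor_r afterA bmor_r -afterA omMl.
Defined.

Definition bimod_cat : category.
Proof.
apply: (@Category bimodule bimod_hom bimod_id bimod_after).
- by move=> X Y f; apply: bimod_hom_eq; exact: idmL.
- by move=> X Y f; apply: bimod_hom_eq; exact: idmR.
- by move=> *; apply: bimod_hom_eq; exact: afterA.
Defined.

Definition bimod_forget : functor bimod_cat M :=
  @Functor bimod_cat M bcar (fun X Y f => bmor f)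
    (fun=> erefl) (fun _ _ _ _ _ => erefl).

Definition reg_bimod : bimod_cat.
Proof.
apply: (@Bimodule A amul amul).
- exact: amulA.
- exact: amul1l.
- exact: amulA.
- exact: amulr1.
- exact: amulA.
Defined.

(* A (x) A with A acting on the left on the first factor and on the right on
   the second one. *)
Definition sq_bimod : bimod_cat.
Proof.
apply: (@Bimodule (A \ox A)
  ((amul \om 1) \after assocV A A A) ((1 \om amul) \after assoc A A A)).
- rewrite omMr -(om1 A A) -(afterA (amul \om 1) _ (amul \om _)) assocV_nat.
  rewrite afterA -omMl amulA !omMl -[LHS]afterA pentagonV.
  rewrite -!afterA (afterA (assocV A A A) (1 \om (_ \om _))) assocV_nat.
  by rewrite -!afterA.
- rewrite -afterA -(om1 A A) assocV_nat afterA -omMl amul1l.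
  by rewrite -lunit_ox -afterA assocVK idmR.
- rewrite omMl -(om1 A A) -!afterA (afterA (assoc A A A) (_ \om 1)) assoc_nat.
  rewrite !afterA -omMr amulA !omMr -!afterA. congr (_ \after _).
  by rewrite (afterA (assoc A A A)) assoc_nat -!afterA pentagon -!afterA.
- rewrite -afterA -(om1 A A) assoc_nat afterA -omMr amulr1.
  exact: runit_ox.
- rewrite omMl omMr -!afterA (afterA (assoc A A A) (_ \om 1)) assoc_nat.
  rewrite (afterA (assocV A A A) (1 \om (_ \om _))) assocV_nat.
  rewrite -!afterA pentagonV' !om1 (afterA (1 \om amul)) (afterA (amul \om 1)).
  by rewrite -om_split -om_split' -!afterA.
Defined.

Definition mul_bimod : @hom bimod_cat sq_bimod reg_bimod.
Proof.
exists (amul : hom (A \ox A) A) => /=.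
- by rewrite afterA amulA -afterA assocVK idmR.
- by rewrite afterA amulA.
Defined.

Definition separable_algebra : Prop := has_section mul_bimod.

(* A kernel is unique up to a unique isomorphism, and being projective is
   invariant under isomorphism, so that the choice of the kernel [Omega] of the
   multiplication in A-bimodules is immaterial. *)
Definition formally_smooth : Prop :=
  exists (Omega : bimod_cat) (i : hom Omega sq_bimod),
    is_kernel mul_bimod i /\ E_projective bimod_forget Omega.

End Bimodules.

(* Lax monoidal functors; they send algebras to algebras and bimodules to
   bimodules. *)
Record monoidal_functor (M N : monoidal_category) := MonoidalFunctor {
  mfun :> functor M N;
  mfun2 : forall X Y : M, hom (mfun X \ox mfun Y) (mfun (X \ox Y));
  mfun0 : hom munit (mfun munit);
  mfun2_nat : forall (X X' Y Y' : M) (f : hom X X') (g : hom Y Y'),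
    fmor mfun (f \om g) \after mfun2 X Y =
    mfun2 X' Y' \after (fmor mfun f \om fmor mfun g);
  mfun_assoc : forall X Y Z : M,
    fmor mfun (assoc X Y Z) \after mfun2 (X \ox Y) Z \after (mfun2 X Y \om 1) =
    mfun2 X (Y \ox Z) \after (1 \om mfun2 Y Z) \after assoc _ _ _;
  mfun_lunit : forall X : M,
    fmor mfun (lunit X) \after mfun2 munit X \after (mfun0 \om 1) = lunit (mfun X);
  mfun_runit : forall X : M,
    fmor mfun (runit X) \after mfun2 X munit \after (1 \om mfun0) = runit (mfun X)
}.

Section Transport.
Variables (M N : monoidal_category) (U : monoidal_functor M N).

Definition himg (X Y Z : M) (f : hom (X \ox Y) Z) : hom (U X \ox U Y) (U Z) :=
  fmor U f \after mfun2 U X Y.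

Lemma mfun2_l (X X' Y : M) (f : hom X X') :
  mfun2 U X' Y \after (fmor U f \om 1) = fmor U (f \om 1) \after mfun2 U X Y.
Proof. by rewrite mfun2_nat fmor1. Qed.

Lemma mfun2_r (X Y Y' : M) (f : hom Y Y') :
  mfun2 U X Y' \after (1 \om fmor U f) = fmor U (1 \om f) \after mfun2 U X Y.
Proof. by rewrite mfun2_nat fmor1. Qed.

Lemma himg_assoc (X Y Z XY YZ T : M) (p : hom (XY \ox Z) T) (q : hom (X \ox Y) XY)
    (r : hom (X \ox YZ) T) (s : hom (Y \ox Z) YZ) :
  p \after (q \om 1) = r \after (1 \om s) \after assoc X Y Z ->
  himg p \after (himg q \om 1) =
  himg r \after (1 \om himg s) \after assoc (U X) (U Y) (U Z).
Proof.
move=> h; rewrite /himg omMl omMr !afterA.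
rewrite -(afterA (fmor U p)) -(afterA (fmor U r)) mfun2_l mfun2_r.
rewrite !afterA -!fmorM h !fmorM -!afterA; do 2 congr (_ \after _).
by rewrite afterA mfun_assoc -!afterA.
Qed.

Lemma himg_lunit (X E : M) (e : hom munit E) (p : hom (E \ox X) X) :
  p \after (e \om 1) = lunit X ->
  himg p \after ((fmor U e \after mfun0 U) \om 1) = lunit (U X).
Proof.
move=> h; rewrite /himg omMl afterA -(afterA (fmor U p)) mfun2_l !afterA.
by rewrite -fmorM h mfun_lunit.
Qed.

Lemma himg_runit (X E : M) (e : hom munit E) (p : hom (X \ox E) X) :
  p \after (1 \om e) = runit X ->
  himg p \after (1 \om (fmor U e \after mfun0 U)) = runit (U X).
Proof.
move=> h; rewrite /himg omMr afterA -(afterA (fmor U p)) mfun2_r !afterA.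
by rewrite -fmorM h mfun_runit.
Qed.

Definition img_alg (A : algebra M) : algebra N.
Proof.
apply: (@MkAlgebra N (U A) (himg amul) (fmor U aone \after mfun0 U)).
- exact: himg_assoc (amulA A).
- exact: himg_lunit (amul1l A).
- exact: himg_runit (amulr1 A).
Defined.

Variable A : algebra M.

Definition img_bimod (X : bimod_cat A) : bimod_cat (img_alg A).
Proof.
apply: (@Bimodule N (img_alg A) (U (bcar X)) (himg (lact X)) (himg (ract X))).
- exact: himg_assoc (lactA X).
- exact: himg_lunit (lact1 X).
- exact: himg_assoc (ractA X).
- exact: himg_runit (ract1 X).
- exact: himg_assoc (lractA X).
Defined.

Definition img_bimod_hom (X Y : bimod_cat A) (f : hom X Y) :
  hom (img_bimod X) (img_bimod Y).
Proof.
exists (fmor U (bmor f) : hom (U (bcar X)) (U (bcar Y))); rewrite /= /himg.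
- by rewrite afterA -fmorM bmor_l -(afterA (fmor U _)) mfun2_r fmorM -!afterA.
- by rewrite afterA -fmorM bmor_r -(afterA (fmor U _)) mfun2_l fmorM -!afterA.
Defined.

Definition img_functor : functor (bimod_cat A) (bimod_cat (img_alg A)).
Proof.
apply: (@Functor _ _ img_bimod img_bimod_hom).
- by move=> X; apply: bimod_hom_eq; exact: fmor1.
- by move=> X Y Z f g; apply: bimod_hom_eq; exact: fmorM.
Defined.
End Transport.

(* A structure [str] carried by the objects of N, with a property [smor] of the
   morphisms of N (those which preserve the structure), in such a way that the
   tensor product, the unit and the constraints of N lift to structured objects.
   The structured objects then form a monoidal category [smonoidal], with a
   monoidal functor [sforget] to N. *)
Record structured (N : monoidal_category) := Structured {
  str : N -> Type;
  smor : forall X Y : N, str X -> str Y -> hom X Y -> Prop;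
  smor1 : forall (X : N) (s : str X), smor s s (idm X);
  smorM : forall (X Y Z : N) (s : str X) (t : str Y) (r : str Z)
    (f : hom Y Z) (g : hom X Y), smor t r f -> smor s t g -> smor s r (f \after g);
  smorV : forall (X Y : N) (s : str X) (t : str Y) (f : hom X Y) (g : hom Y X),
    g \after f = idm X -> f \after g = idm Y -> smor s t f -> smor t s g;
  str_ox : forall X Y : N, str X -> str Y -> str (X \ox Y);
  str_unit : str munit;
  smor_om : forall (X X' Y Y' : N) (s : str X) (s' : str X') (t : str Y)
    (t' : str Y') (f : hom X X') (g : hom Y Y'),
    smor s s' f -> smor t t' g -> smor (str_ox s t) (str_ox s' t') (f \om g);
  smor_assoc : forall (X Y Z : N) (s : str X) (t : str Y) (r : str Z),
    smor (str_ox (str_ox s t) r) (str_ox s (str_ox t r)) (assoc X Y Z);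
  smor_lunit : forall (X : N) (s : str X), smor (str_ox str_unit s) s (lunit X);
  smor_runit : forall (X : N) (s : str X), smor (str_ox s str_unit) s (runit X)
}.
Arguments smor {_} _ {_ _} _ _ _.
Arguments str_ox {_} _ {_ _} _ _.
Arguments str_unit {_} _.

Section Structured.
Variables (N : monoidal_category) (S : structured N).

Record sobj := SObj { scar : N; sstr : str S scar }.
Record shom (X Y : sobj) := SHom {
  smap : hom (scar X) (scar Y);
  smapP : smor S (sstr X) (sstr Y) smap
}.

Lemma shom_eq X Y (f g : shom X Y) : smap f = smap g -> f = g.
Proof.
case: f g => [f hf] [g hg] /= fg; move: hf hg; rewrite fg => hf hg.
by rewrite (Prop_irrelevance hf hg).
Qed.

Definition scat : category.
Proof.
apply: (@Category sobj shom (fun X => SHom (smor1 (sstr X)))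
  (fun X Y Z f g => SHom (smorM (smapP f) (smapP g)))).
- by move=> X Y f; apply: shom_eq; exact: idmL.
- by move=> X Y f; apply: shom_eq; exact: idmR.
- by move=> *; apply: shom_eq; exact: afterA.
Defined.

Definition sox (X Y : scat) : scat := SObj (str_ox S (sstr X) (sstr Y)).
Definition som (X X' Y Y' : scat) (f : hom X X') (g : hom Y Y') :
  hom (sox X Y) (sox X' Y') :=
  @SHom (sox X Y) (sox X' Y') _ (smor_om (smapP f) (smapP g)).
Definition sunit : scat := SObj (str_unit S).
Definition sassoc (X Y Z : scat) : hom (sox (sox X Y) Z) (sox X (sox Y Z)) :=
  @SHom (sox (sox X Y) Z) (sox X (sox Y Z)) _ (smor_assoc (sstr X) (sstr Y) (sstr Z)).
Definition sassocV (X Y Z : scat) : hom (sox X (sox Y Z)) (sox (sox X Y) Z) :=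
  @SHom (sox X (sox Y Z)) (sox (sox X Y) Z) _ (smorV (assocK _ _ _) (assocVK _ _ _)
              (smor_assoc (sstr X) (sstr Y) (sstr Z))).
Definition slunit (X : scat) : hom (sox sunit X) X :=
  @SHom (sox sunit X) X _ (smor_lunit (sstr X)).
Definition slunitV (X : scat) : hom X (sox sunit X) :=
  @SHom X (sox sunit X) _ (smorV (lunitK _) (lunitVK _) (smor_lunit (sstr X))).
Definition srunit (X : scat) : hom (sox X sunit) X :=
  @SHom (sox X sunit) X _ (smor_runit (sstr X)).
Definition srunitV (X : scat) : hom X (sox X sunit) :=
  @SHom X (sox X sunit) _ (smorV (runitK _) (runitVK _) (smor_runit (sstr X))).

Definition smonoidal : monoidal_category.
Proof.
apply: (@MonoidalCategory scat sox som sunit sassoc sassocV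
          slunit slunitV srunit srunitV); move=> *; apply: shom_eq => /=.
- exact: om1.
- exact: omM.
- exact: assocK.
- exact: assocVK.
- exact: lunitK.
- exact: lunitVK.
- exact: runitK.
- exact: runitVK.
- exact: assoc_nat.
- exact: lunit_nat.
- exact: runit_nat.
- exact: pentagon.
- exact: triangle.
Defined.

Definition sforget_functor : functor smonoidal N :=
  @Functor smonoidal N scar (fun X Y f => smap f)
    (fun=> erefl) (fun _ _ _ _ _ => erefl).

Definition sforget : monoidal_functor smonoidal N.
Proof.
apply: (@MonoidalFunctor smonoidal N sforget_functor
          (fun X Y => idm (scar X \ox scar Y)) (idm munit)) => /= *.
- by rewrite idmL idmR.
- by rewrite !om1 !idmR !idmL.
- by rewrite om1 !idmR.
- by rewrite om1 !idmR.
Defined.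
End Structured.

Section Vect.
Variable K : fieldType.

Definition vect_cat : category.
Proof.
apply: (@Category (lmodType K) (fun V W => {linear V -> W})
         (fun V => (idfun : {linear V -> V}))
         (fun V W U g f => (g \o f : {linear V -> U}))).
- by move=> *; exact: linear_ext.
- by move=> *; exact: linear_ext.
- by move=> *; exact: linear_ext.
Defined.

Definition tensorL (V W : lmodType K) : lmodType K := tensor V W.
Definition baseL : lmodType K := K^o.

Definition vect : monoidal_category.
Proof.
apply: (@MonoidalCategory vect_cat tensorL
  (fun V V' W W' f g => tmap f g) baseL (@tassoc K) (@tassocV K)
  (@tlunit K) (@tlunitV K) (@trunit K) (@trunitV K)).
- by move=> V W; apply: tensor_ext => v w /=; rewrite tmapE.
- by move=> *; apply: tensor_ext => v w; rewrite /= !tmapE.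
- by move=> *; apply: tensor_ext3 => v w x; rewrite /= tassocE tassocVE.
- by move=> *; apply: tensor_ext3' => v w x; rewrite /= tassocVE tassocE.
- move=> V; apply: tensor_ext => k v /=.
  by rewrite tlunitE pureZr -pureZl [_ *: _]mulr1.
- by move=> V; apply: linear_ext => v /=; rewrite tlunitE scale1r.
- move=> V; apply: tensor_ext => v k /=.
  by rewrite trunitE pureZl -pureZr [_ *: _]mulr1.
- by move=> V; apply: linear_ext => v /=; rewrite trunitE scale1r.
- by move=> *; apply: tensor_ext3 => v w x; rewrite /= !(tassocE, tmapE).
- by move=> *; apply: tensor_ext => k v; rewrite /= !(tmapE, tlunitE) linearZ.
- by move=> *; apply: tensor_ext => v k; rewrite /= !(tmapE, trunitE) linearZ.
- by move=> *; apply: tensor_ext4 => v w x y; rewrite /= !(tassocE, tmapE).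
- move=> *; apply: tensor_ext3 => v k w.
  by rewrite /= tassocE !tmapE /= tlunitE trunitE pureZl pureZr.
Defined.
End Vect.

Section Hopf.
Local Open Scope ring_scope.
Variable K : fieldType.

Definition mul_map (H : algType K) : {linear tensor H H -> H}.
Proof.
apply: (@lift K H H H *%R); split=> z a x y.
- by rewrite mulrDr scalerAr.
- by rewrite mulrDl scalerAl.
Defined.

Lemma mul_mapE (H : algType K) (g h : H) : mul_map H (pure g h) = g * h.
Proof. exact: liftE. Qed.

(* [algType] excludes the zero ring; this is no restriction since eps 1 = 1. *)
Record hopf_algebra := HopfAlgebra {
  hcar :> algType K;
  Delta : {linear hcar -> tensor hcar hcar};
  eps : {linear hcar -> K^o};
  antipode : {linear hcar -> hcar};
  DeltaA : forall h,
    tassoc _ _ _ (tmap Delta idfun (Delta h)) = tmap idfun Delta (Delta h);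
  DeltaL : forall h, tlunit _ (tmap eps idfun (Delta h)) = h;
  DeltaR : forall h, trunit _ (tmap idfun eps (Delta h)) = h;
  Delta1 : Delta 1 = pure 1 1;
  DeltaM : forall g h, Delta (g * h) =
    tmap (mul_map hcar) (mul_map hcar) (tswap _ _ _ _ (pure (Delta g) (Delta h)));
  eps1 : eps 1 = 1;
  epsM : forall g h, eps (g * h) = eps g * eps h;
  antipodeL : forall h, mul_map hcar (tmap antipode idfun (Delta h)) = eps h *: 1;
  antipodeR : forall h, mul_map hcar (tmap idfun antipode (Delta h)) = eps h *: 1
}.
End Hopf.
Arguments Delta {_ _}.
Arguments eps {_ _}.
Arguments antipode {_ _}.


Section Comodules.
Local Open Scope ring_scope.
Variables (K : fieldType) (H : hopf_algebra K).
Implicit Types V W X : lmodType K.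

Definition right_coassoc V (rho : {linear V -> tensor V H}) : Prop :=
  forall v, tassoc _ _ _ (tmap rho idfun (rho v)) = tmap idfun Delta (rho v).
Definition right_counit V (rho : {linear V -> tensor V H}) : Prop :=
  forall v, trunit _ (tmap idfun eps (rho v)) = v.
Definition left_coassoc V (lam : {linear V -> tensor H V}) : Prop :=
  forall v, tassoc _ _ _ (tmap Delta idfun (lam v)) = tmap idfun lam (lam v).
Definition left_counit V (lam : {linear V -> tensor H V}) : Prop :=
  forall v, tlunit _ (tmap eps idfun (lam v)) = v.

Definition right_colinear V W (rho : {linear V -> tensor V H})
    (rho' : {linear W -> tensor W H}) (f : {linear V -> W}) : Prop :=
  forall v, rho' (f v) = tmap f idfun (rho v).
Definition left_colinear V W (lam : {linear V -> tensor H V})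
    (lam' : {linear W -> tensor H W}) (f : {linear V -> W}) : Prop :=
  forall v, lam' (f v) = tmap idfun f (lam v).

(* (v (x) h) (x) (w (x) k) |-> (v (x) w) (x) h k, and its left-hand version;
   the codiagonal coactions are obtained from it. *)
Definition right_mm V W :
    {linear tensor (tensor V H) (tensor W H) -> tensor (tensor V W) H} :=
  tmap idfun (mul_map H) \o tswap V H W H.
Definition left_mm V W :
    {linear tensor (tensor H V) (tensor H W) -> tensor H (tensor V W)} :=
  tmap (mul_map H) idfun \o tswap H V H W.

Definition right_codiag V W (rV : {linear V -> tensor V H})
    (rW : {linear W -> tensor W H}) : {linear tensor V W -> tensor (tensor V W) H} :=
  right_mm V W \o tmap rV rW.
Definition left_codiag V W (lV : {linear V -> tensor H V})
    (lW : {linear W -> tensor H W}) : {linear tensor V W -> tensor H (tensor V W)} :=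
  left_mm V W \o tmap lV lW.

Definition right_triv : {linear K^o -> tensor K^o H} :=
  mk_linear ((pure_bilin K^o H).2 1).
Definition left_triv : {linear K^o -> tensor H K^o} :=
  mk_linear ((pure_bilin H K^o).1 1).


Lemma right_mmE V W (v : V) (w : W) (h k : H) :
  right_mm V W (pure (pure v h) (pure w k)) = pure (pure v w) (h * k).
Proof. by rewrite /right_mm/= tswapE tmapE mul_mapE. Qed.
Lemma left_mmE V W (v : V) (w : W) (h k : H) :
  left_mm V W (pure (pure h v) (pure k w)) = pure (h * k) (pure v w).
Proof. by rewrite /left_mm/= tswapE tmapE mul_mapE. Qed.

Lemma right_codiagE V W rV rW (v : V) (w : W) :
  right_codiag rV rW (pure v w) = right_mm V W (pure (rV v) (rW w)).
Proof. by rewrite [LHS]/= tmapE. Qed.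
Lemma left_codiagE V W lV lW (v : V) (w : W) :
  left_codiag lV lW (pure v w) = left_mm V W (pure (lV v) (lW w)).
Proof. by rewrite [LHS]/= tmapE. Qed.

Definition rmm2 V W : {linear tensor (tensor V (tensor H H)) (tensor W (tensor H H)) ->
    tensor (tensor V W) (tensor H H)} :=
  tmap idfun (tmap (mul_map H) (mul_map H) \o tswap _ _ _ _) \o tswap _ _ _ _.
Definition lmm2 V W : {linear tensor (tensor H (tensor H V)) (tensor H (tensor H W)) ->
    tensor H (tensor H (tensor V W))} :=
  tmap (mul_map H) (left_mm V W) \o tswap _ _ _ _.
Definition lrmm V W : {linear tensor (tensor H (tensor V H)) (tensor H (tensor W H)) ->
    tensor H (tensor (tensor V W) H)} :=
  tmap (mul_map H) (right_mm V W) \o tswap _ _ _ _.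

Local Ltac tind x :=
  elim/tensor_ind: x => [? ?|? ?];
  last by rewrite /= !(pureDl, pureDr, linearD) /=; move=> -> ->.
Local Ltac tcomp := rewrite /=;
  do ?(rewrite !(tmapE, tassocE, tassocVE, tswapE, mul_mapE, tlunitE, trunitE) /=).

Lemma right_codiagA1 V W rV rW (x : tensor V H) (y : tensor W H) :
  tassoc _ _ _ (tmap (right_codiag rV rW) idfun (right_mm V W (pure x y))) =
  rmm2 V W (pure (tassoc _ _ _ (tmap rV idfun x)) (tassoc _ _ _ (tmap rW idfun y))).
Proof.
tind x; tind y; tcomp; move: (rV _) (rW _) => x y.
by tind x; tind y; tcomp.
Qed.

Lemma right_codiagA2 V W (x : tensor V H) (y : tensor W H) :
  tmap idfun Delta (right_mm V W (pure x y)) =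
  rmm2 V W (pure (tmap idfun Delta x) (tmap idfun Delta y)).
Proof. by tind x; tind y; tcomp; rewrite DeltaM. Qed.

Lemma right_codiagA V W rV rW : right_coassoc rV -> right_coassoc rW ->
  right_coassoc (@right_codiag V W rV rW).
Proof.
move=> hV hW t; tind t; rewrite right_codiagE.
by rewrite right_codiagA1 right_codiagA2 hV hW.
Qed.

Lemma right_codiagU1 V W (x : tensor V H) (y : tensor W H) :
  trunit _ (tmap idfun eps (right_mm V W (pure x y))) =
  pure (trunit _ (tmap idfun eps x)) (trunit _ (tmap idfun eps y)).
Proof. by tind x; tind y; tcomp; rewrite epsM pureZl pureZr scalerA. Qed.

Lemma right_codiagU V W rV rW : right_counit rV -> right_counit rW ->
  right_counit (@right_codiag V W rV rW).
Proof.
move=> hV hW t; tind t; rewrite right_codiagE.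
by rewrite right_codiagU1 hV hW.
Qed.

Lemma left_codiagA1 V W lV lW (x : tensor H V) (y : tensor H W) :
  tmap idfun (left_codiag lV lW) (left_mm V W (pure x y)) =
  lmm2 V W (pure (tmap idfun lV x) (tmap idfun lW y)).
Proof. by tind x; tind y; tcomp. Qed.

Lemma left_codiagA2 V W (x : tensor H V) (y : tensor H W) :
  tassoc _ _ _ (tmap Delta idfun (left_mm V W (pure x y))) =
  lmm2 V W (pure (tassoc _ _ _ (tmap Delta idfun x)) (tassoc _ _ _ (tmap Delta idfun y))).
Proof.
tind x; tind y; tcomp; rewrite DeltaM; move: (Delta _) (Delta _) => x y.
by tind x; tind y; tcomp.
Qed.

Lemma left_codiagA V W lV lW : left_coassoc lV -> left_coassoc lW ->
  left_coassoc (@left_codiag V W lV lW).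
Proof.
move=> hV hW t; tind t; rewrite left_codiagE.
by rewrite left_codiagA1 left_codiagA2 hV hW.
Qed.

Lemma bicodiag1 V W lV lW (x : tensor V H) (y : tensor W H) :
  tassoc _ _ _ (tmap (left_codiag lV lW) idfun (right_mm V W (pure x y))) =
  lrmm V W (pure (tassoc _ _ _ (tmap lV idfun x)) (tassoc _ _ _ (tmap lW idfun y))).
Proof.
tind x; tind y; tcomp; move: (lV _) (lW _) => x y.
by tind x; tind y; tcomp.
Qed.

Lemma bicodiag2 V W rV rW (x : tensor H V) (y : tensor H W) :
  tmap idfun (right_codiag rV rW) (left_mm V W (pure x y)) =
  lrmm V W (pure (tmap idfun rV x) (tmap idfun rW y)).
Proof. by tind x; tind y; tcomp. Qed.

Lemma left_codiagU1 V W (x : tensor H V) (y : tensor H W) :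
  tlunit _ (tmap eps idfun (left_mm V W (pure x y))) =
  pure (tlunit _ (tmap eps idfun x)) (tlunit _ (tmap eps idfun y)).
Proof. by tind x; tind y; tcomp; rewrite epsM pureZl pureZr scalerA. Qed.

Lemma left_codiagU V W lV lW : left_counit lV -> left_counit lW ->
  left_counit (@left_codiag V W lV lW).
Proof.
by move=> hV hW t; tind t; rewrite left_codiagE left_codiagU1 hV hW.
Qed.

Lemma bicodiag V W (lV : {linear V -> tensor H V}) (lW : {linear W -> tensor H W})
    (rV : {linear V -> tensor V H}) (rW : {linear W -> tensor W H}) :
  (forall v, tassoc _ _ _ (tmap lV idfun (rV v)) = tmap idfun rV (lV v)) ->
  (forall w, tassoc _ _ _ (tmap lW idfun (rW w)) = tmap idfun rW (lW w)) ->
  forall t, tassoc _ _ _ (tmap (left_codiag lV lW) idfun (@right_codiag V W rV rW t))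
    = tmap idfun (right_codiag rV rW) (left_codiag lV lW t).
Proof.
move=> hV hW t; tind t; rewrite left_codiagE right_codiagE.
by rewrite bicodiag1 bicodiag2 hV hW.
Qed.

Lemma right_trivA : right_coassoc right_triv.
Proof. by move=> k; tcomp; rewrite Delta1. Qed.
Lemma right_trivU : right_counit right_triv.
Proof. by move=> k; tcomp; rewrite eps1 [_ *: _]mul1r. Qed.
Lemma left_trivA : left_coassoc left_triv.
Proof. by move=> k; tcomp; rewrite Delta1 tassocE. Qed.
Lemma left_trivU : left_counit left_triv.
Proof. by move=> k; tcomp; rewrite eps1 scale1r. Qed.
Lemma bitriv k :
  tassoc _ _ _ (tmap left_triv idfun (right_triv k)) =
  tmap idfun right_triv (left_triv k).
Proof. by tcomp. Qed.

Lemma right_om1 V V' W W' (f : {linear V -> V'}) (g : {linear W -> W'})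
    (x : tensor V H) (y : tensor W H) :
  right_mm V' W' (pure (tmap f idfun x) (tmap g idfun y)) =
  tmap (tmap f g) idfun (right_mm V W (pure x y)).
Proof. by tind x; tind y; tcomp. Qed.

Lemma left_om1 V V' W W' (f : {linear V -> V'}) (g : {linear W -> W'})
    (x : tensor H V) (y : tensor H W) :
  left_mm V' W' (pure (tmap idfun f x) (tmap idfun g y)) =
  tmap idfun (tmap f g) (left_mm V W (pure x y)).
Proof. by tind x; tind y; tcomp. Qed.

Lemma right_om V V' W W' rV rV' rW rW' (f : {linear V -> V'})
    (g : {linear W -> W'}) : right_colinear rV rV' f -> right_colinear rW rW' g ->
  right_colinear (right_codiag rV rW) (right_codiag rV' rW') (tmap f g).
Proof.
move=> hf hg t; tind t.
by rewrite tmapE !right_codiagE hf hg right_om1.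
Qed.

Lemma left_om V V' W W' lV lV' lW lW' (f : {linear V -> V'})
    (g : {linear W -> W'}) : left_colinear lV lV' f -> left_colinear lW lW' g ->
  left_colinear (left_codiag lV lW) (left_codiag lV' lW') (tmap f g).
Proof.
move=> hf hg t; tind t.
by rewrite tmapE !left_codiagE hf hg left_om1.
Qed.

Lemma right_assoc1 V W X (x : tensor V H) (y : tensor W H) (z : tensor X H) :
  right_mm _ _ (pure x (right_mm _ _ (pure y z))) =
  tmap (tassoc V W X) idfun (right_mm _ _ (pure (right_mm _ _ (pure x y)) z)).
Proof. by tind x; tind y; tind z; tcomp; rewrite mulrA. Qed.

Lemma left_assoc1 V W X (x : tensor H V) (y : tensor H W) (z : tensor H X) :
  left_mm _ _ (pure x (left_mm _ _ (pure y z))) =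
  tmap idfun (tassoc V W X) (left_mm _ _ (pure (left_mm _ _ (pure x y)) z)).
Proof. by tind x; tind y; tind z; tcomp; rewrite mulrA. Qed.

Lemma right_assoc V W X rV rW rX :
  right_colinear (right_codiag (right_codiag rV rW) rX)
    (right_codiag rV (right_codiag rW rX)) (tassoc V W X).
Proof.
move=> t; elim/tensor_ind: t => [t x|? ?]; first tind t.
  by rewrite tassocE !right_codiagE right_assoc1.
by rewrite !linearD => -> ->.
Qed.

Lemma left_assoc V W X lV lW lX :
  left_colinear (left_codiag (left_codiag lV lW) lX)
    (left_codiag lV (left_codiag lW lX)) (tassoc V W X).
Proof.
move=> t; elim/tensor_ind: t => [t x|? ?]; first tind t.
  by rewrite tassocE !left_codiagE left_assoc1.
by rewrite !linearD => -> ->.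
Qed.

Lemma right_lunit1 V k (x : tensor V H) :
  k *: x = tmap (tlunit V) idfun (right_mm K^o V (pure (pure (k : K^o) 1) x)).
Proof. by tind x; tcomp; rewrite mul1r pureZl. Qed.
Lemma right_runit1 V k (x : tensor V H) :
  k *: x = tmap (trunit V) idfun (right_mm V K^o (pure x (pure (k : K^o) 1))).
Proof. by tind x; tcomp; rewrite mulr1 pureZl. Qed.
Lemma left_lunit1 V k (x : tensor H V) :
  k *: x = tmap idfun (tlunit V) (left_mm K^o V (pure (pure 1 (k : K^o)) x)).
Proof. by tind x; tcomp; rewrite mul1r pureZr. Qed.
Lemma left_runit1 V k (x : tensor H V) :
  k *: x = tmap idfun (trunit V) (left_mm V K^o (pure x (pure 1 (k : K^o)))).
Proof. by tind x; tcomp; rewrite mulr1 pureZr. Qed.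

Lemma right_lunit V rV : right_colinear (right_codiag right_triv rV) rV (tlunit V).
Proof.
move=> t; tind t; rewrite tlunitE right_codiagE linearZ.
exact: right_lunit1.
Qed.
Lemma right_runit V rV : right_colinear (right_codiag rV right_triv) rV (trunit V).
Proof.
move=> t; tind t; rewrite trunitE right_codiagE linearZ.
exact: right_runit1.
Qed.
Lemma left_lunit V lV : left_colinear (left_codiag left_triv lV) lV (tlunit V).
Proof.
move=> t; tind t; rewrite tlunitE left_codiagE linearZ.
exact: left_lunit1.
Qed.
Lemma left_runit V lV : left_colinear (left_codiag lV left_triv) lV (trunit V).
Proof.
move=> t; tind t; rewrite trunitE left_codiagE linearZ.
exact: left_runit1.
Qed.

Lemma tmap_comp V V' V'' W W' W'' (f' : {linear V' -> V''}) (f : {linear V -> V'})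
    (g' : {linear W' -> W''}) (g : {linear W -> W'})
    (h : {linear V -> V''}) (k : {linear W -> W''}) :
  (forall v, h v = f' (f v)) -> (forall w, k w = g' (g w)) ->
  forall t, tmap f' g' (tmap f g t) = tmap h k t.
Proof. by move=> eh ek t; tind t; rewrite !tmapE eh ek. Qed.

Lemma tmap_id V W (f : {linear V -> V}) (g : {linear W -> W}) t :
  f =1 id -> g =1 id -> tmap f g t = t.
Proof. by move=> hf hg; tind t; rewrite tmapE hf hg. Qed.

Lemma right_colinear1 V rV : right_colinear rV rV (idfun : {linear V -> V}).
Proof. by move=> v; rewrite tmap_id. Qed.
Lemma left_colinear1 V lV : left_colinear lV lV (idfun : {linear V -> V}).
Proof. by move=> v; rewrite tmap_id. Qed.

Lemma right_colinearM V W X rV rW rX (f : {linear W -> X}) (g : {linear V -> W}) :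
  right_colinear rW rX f -> right_colinear rV rW g ->
  right_colinear rV rX (f \o g).
Proof. move=> hf hg v; rewrite [LHS]/= hf hg; exact: tmap_comp. Qed.
Lemma left_colinearM V W X lV lW lX (f : {linear W -> X}) (g : {linear V -> W}) :
  left_colinear lW lX f -> left_colinear lV lW g ->
  left_colinear lV lX (f \o g).
Proof. move=> hf hg v; rewrite [LHS]/= hf hg; exact: tmap_comp. Qed.

Lemma right_colinearV V W rV rW (f : {linear V -> W}) (g : {linear W -> V}) :
  cancel f g -> cancel g f -> right_colinear rV rW f -> right_colinear rW rV g.
Proof.
move=> fK gK hf w; rewrite -[w in RHS]gK hf (@tmap_comp _ _ _ _ _ _ _ _ _ _ idfun idfun) //.
by rewrite tmap_id.
Qed.
Lemma left_colinearV V W lV lW (f : {linear V -> W}) (g : {linear W -> V}) :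
  cancel f g -> cancel g f -> left_colinear lV lW f -> left_colinear lW lV g.
Proof.
move=> fK gK hf w; rewrite -[w in RHS]gK hf (@tmap_comp _ _ _ _ _ _ _ _ _ _ idfun idfun) //.
by rewrite tmap_id.
Qed.

Record right_comodule V := RightComodule {
  rho : {linear V -> tensor V H};
  rhoA : right_coassoc rho;
  rhoU : right_counit rho
}.

Record bicomodule V := Bicomodule {
  bright : {linear V -> tensor V H};
  bleft : {linear V -> tensor H V};
  brightA : right_coassoc bright;
  brightU : right_counit bright;
  bleftA : left_coassoc bleft;
  bleftU : left_counit bleft;
  bicomod_compat : forall v,
    tassoc _ _ _ (tmap bleft idfun (bright v)) = tmap idfun bright (bleft v)
}.

Definition right_comodule_ox V W (r : right_comodule V) (s : right_comodule W) :
    right_comodule (tensorL V W) :=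
  @RightComodule (tensorL V W) (right_codiag (rho r) (rho s))
    (right_codiagA (rhoA r) (rhoA s)) (right_codiagU (rhoU r) (rhoU s)).

Definition bicomodule_ox V W (r : bicomodule V) (s : bicomodule W) :
    bicomodule (tensorL V W) :=
  @Bicomodule (tensorL V W) (right_codiag (bright r) (bright s))
    (left_codiag (bleft r) (bleft s))
    (right_codiagA (brightA r) (brightA s)) (right_codiagU (brightU r) (brightU s))
    (left_codiagA (bleftA r) (bleftA s)) (left_codiagU (bleftU r) (bleftU s))
    (bicodiag (bicomod_compat r) (bicomod_compat s)).

Definition right_comodule_unit : right_comodule (baseL K) :=
  @RightComodule (baseL K) right_triv right_trivA right_trivU.
Definition bicomodule_unit : bicomodule (baseL K) :=
  @Bicomodule (baseL K) right_triv left_triv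
    right_trivA right_trivU left_trivA left_trivU bitriv.

Lemma vect_cancel (V W : vect K) (f : hom V W) (g : hom W V) :
  after g f = idm V -> cancel f g.
Proof. by move=> e v; exact: (congr1 (fun h : {linear V -> V} => h v) e). Qed.

Definition right_comodule_str : structured (vect K).
Proof.
apply: (@Structured (vect K) right_comodule
  (fun V W r s f => right_colinear (rho r) (rho s) f) _ _ _
  right_comodule_ox right_comodule_unit) => /=.
- by move=> *; exact: right_colinear1.
- by move=> V W U r s t f g hf hg; exact: right_colinearM hf hg.
- by move=> V W r s f g fg gf; apply: right_colinearV; exact: vect_cancel.
- by move=> *; exact: right_om.
- by move=> *; exact: right_assoc.
- by move=> *; exact: right_lunit.
- by move=> *; exact: right_runit.
Defined.

Definition bicomodule_str : structured (vect K).
Proof.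
apply: (@Structured (vect K) bicomodule
  (fun V W r s f => right_colinear (bright r) (bright s) f /\
                    left_colinear (bleft r) (bleft s) f) _ _ _
  bicomodule_ox bicomodule_unit) => /=.
- by move=> *; split; [exact: right_colinear1 | exact: left_colinear1].
- move=> V W U r s t f g [hf hf'] [hg hg'].
  by split; [exact: right_colinearM hf hg | exact: left_colinearM hf' hg'].
- move=> V W r s f g fg gf [hr hl]; split.
    by apply: right_colinearV hr; exact: vect_cancel.
  by apply: left_colinearV hl; exact: vect_cancel.
- by move=> V V' W W' r r' s s' f g [hf hf'] [hg hg'];
     split; [exact: right_om | exact: left_om].
- by move=> *; split; [exact: right_assoc | exact: left_assoc].
- by move=> *; split; [exact: right_lunit | exact: left_lunit].
- by move=> *; split; [exact: right_runit | exact: left_runit].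
Defined.

Inductive comod_kind := RightComod | Bicomod.

Definition comod_str (s : comod_kind) : structured (vect K) :=
  match s with RightComod => right_comodule_str | Bicomod => bicomodule_str end.

Definition comod (s : comod_kind) : monoidal_category := smonoidal (comod_str s).
Definition comod_forget (s : comod_kind) : monoidal_functor (comod s) (vect K) :=
  sforget (comod_str s).

End Comodules.

(* Main.v *)
(** [P] is projective relative to the forgetful functor exactly when the action
    [(A (x) P) (x) A -> P] splits in bimodules, since the free bimodule is
    projective and the action is split in the base category by
    [x |-> (1 (x) x) (x) 1].  Such a splitting is preserved by [F], as is a
    splitting of the multiplication.  Conversely, a natural left inverse of [F]
    on morphisms turns a factorization of [F g] through [F f] into one of [g]
    through [f].  For formal smoothness, the multiplication is split in the base
    category by [a |-> a (x) 1], so that its kernel is a retract of [A (x) A],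
    hence a subcomodule and a subbimodule whose image under [F] is again a kernel
    of the multiplication: no exactness of the tensor product is needed. *)
From HB Require Import structures.
From mathcomp Require Import all_boot all_algebra.
Require Import Defs.

Set Implicit Arguments.
Unset Strict Implicit.
Unset Printing Implicit Defensive.

Import GRing.Theory.
Local Open Scope cat_scope.

(** * Relative projectivity and free bimodules *)

Section Categories.
Variable C : category.

(** Formal smoothness is stated with some kernel of the multiplication; this isomorphism carries
    projectivity over to a kernel built by hand. *)
Lemma kernel_iso (X Y N N' : C) (f : hom X Y) (i : hom N X) (i' : hom N' X) :
  is_kernel f i -> is_kernel f i' ->
  exists (s : hom N N') (s' : hom N' N), s \after s' = 1 /\ s' \after s = 1.
Proof.
have key (P P' : C) (j : hom P X) (j' : hom P' X) (t : hom P P') (t' : hom P' P) :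
    is_kernel f j -> j' \after t = j -> j \after t' = j' -> t' \after t = 1.
  move=> [zj uj] jt jt'; have [w [_ uw]] := uj _ _ zj.
  by rewrite -(uw 1 (idmR _)) -(uw (t' \after t)) // afterA jt'.
move=> hi hi'; have [s' [es' _]] := hi.2 _ _ hi'.1.
have [s [es _]] := hi'.2 _ _ hi.1.
by exists s, s'; split; [exact: key hi' es' es | exact: key hi es es'].
Qed.

Lemma retract_projective (D : category) (G : functor C D) (P Q : C)
    (i : hom P Q) (p : hom Q P) :
  p \after i = 1 -> E_projective G Q -> E_projective G P.
Proof.
move=> pi hQ X Y f hf g; have [h fh] := hQ _ _ _ hf (g \after p).
by exists (h \after i); rewrite afterA fh -afterA pi idmR.
Qed.

Lemma has_section_fmor (D : category) (G : functor C D) (X Y : C) (f : hom X Y) :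
  has_section f -> has_section (fmor G f).
Proof. by case=> s fs; exists (fmor G s); rewrite -fmorM fs fmor1. Qed.

(** By naturality the left inverse [T] sends [fmor F f \after h] to [f \after T h], and it sends
    [fmor F g] back to [g]. *)
Lemma separable_lift (D : category) (F : functor C D) (P X Y : C)
    (f : hom X Y) (g : hom P Y) : separable_functor F ->
  (exists h, fmor F f \after h = fmor F g) -> exists h, f \after h = g.
Proof.
move=> [T [Tnat TF]] [h fh]; exists (T _ _ h).
by rewrite -[LHS]idmR -Tnat fmor1 idmR fh TF.
Qed.
End Categories.

Section LeftModule.
Variables (M : monoidal_category) (A : algebra M).
Variables (L : M) (l : hom (A \ox L) L).
Hypothesis lA : l \after (amul \om 1) = l \after (1 \om l) \after assoc _ _ _.
Hypothesis l1 : l \after (aone \om 1) = lunit L.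

(** The bimodule induced by a left module [L]. Taking for [L] the free left module on [X] yields the
    free bimodule on [X], so that freeness is handled one side at a time. *)
Definition right_free : bimod_cat A.
Proof.
apply: (@Bimodule M A (L \ox A)
  ((l \om 1) \after assocV A L A) ((1 \om amul) \after assoc L A A)).
- rewrite omMr -(om1 L A) -(afterA (l \om 1) _ (amul \om _)) assocV_nat.
  rewrite afterA -omMl lA !omMl -[LHS]afterA pentagonV.
  rewrite -!afterA (afterA (assocV _ _ _) (1 \om (_ \om _))) assocV_nat.
  by rewrite -!afterA.
- rewrite -afterA -(om1 L A) assocV_nat afterA -omMl l1.
  by rewrite -lunit_ox -afterA assocVK idmR.
- rewrite omMl -(om1 L A) -!afterA (afterA (assoc L A A) (_ \om 1)) assoc_nat.
  rewrite !afterA -omMr amulA !omMr -!afterA; congr (_ \after _).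
  by rewrite (afterA (assoc L A A)) assoc_nat -!afterA pentagon -!afterA.
- rewrite -afterA -(om1 L A) assoc_nat afterA -omMr amulr1.
  exact: runit_ox.
- rewrite omMl omMr -!afterA (afterA (assoc L A A) (_ \om 1)) assoc_nat.
  rewrite (afterA (assocV _ _ A) (1 \om (_ \om _))) assocV_nat.
  rewrite -!afterA pentagonV' !om1 (afterA (1 \om amul)) (afterA (l \om 1)).
  by rewrite -om_split -om_split' -!afterA.
Defined.

Definition right_free_lift (Y : bimod_cat A) (g : hom L (bcar Y))
    (gl : g \after l = lact Y \after (1 \om g)) : hom right_free Y.
Proof.
exists (ract Y \after (g \om 1)) => /=.
- rewrite -(afterA (ract Y)) (afterA (_ \om 1)) -omMl gl omMl -(afterA _ _ (assocV _ _ _)).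
  rewrite -assocV_nat !afterA lractA -!afterA (afterA (assoc _ _ _)) assocVK idmL.
  by rewrite -omMr.
- rewrite omMl !afterA ractA -!afterA; congr (_ \after _).
  by rewrite assoc_nat om1 (afterA (_ \om amul)) -om_split' afterA -om_split.
Defined.
End LeftModule.

Section FreeBimodule.
Variables (M : monoidal_category) (A : algebra M).

Definition free_lact (X : M) : hom (A \ox (A \ox X)) (A \ox X) :=
  (amul \om 1) \after assocV A A X.

Lemma free_lactA (X : M) :
  free_lact X \after (amul \om 1) =
  free_lact X \after (1 \om free_lact X) \after assoc _ _ _.
Proof.
rewrite /free_lact omMr -(om1 A X) -(afterA (amul \om 1) _ (amul \om _)) assocV_nat.
rewrite afterA -omMl amulA !omMl -[LHS]afterA pentagonV.
rewrite -!afterA (afterA (assocV A A X) (1 \om (_ \om _))) assocV_nat.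
by rewrite -!afterA.
Qed.

Lemma free_lact1 (X : M) : free_lact X \after (aone \om 1) = lunit _.
Proof.
rewrite /free_lact -afterA -(om1 A X) assocV_nat afterA -omMl amul1l.
by rewrite -lunit_ox -afterA assocVK idmR.
Qed.

Lemma free_lact_lift (X : M) (Y : bimod_cat A) (x : hom X (bcar Y)) :
  lact Y \after (1 \om x) \after free_lact X =
  lact Y \after (1 \om (lact Y \after (1 \om x))).
Proof.
rewrite /free_lact -(afterA (lact Y) (1 \om x)) (afterA (1 \om x)).
rewrite -om_split' om_split -(om1 A A) -afterA -assocV_nat !afterA lactA.
by rewrite -!afterA (afterA (assoc _ _ _)) assocVK idmL -omMr.
Qed.

Definition free_bimod (X : M) : bimod_cat A :=
  right_free (free_lactA X) (free_lact1 X).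

Definition free_lift (X : M) (Y : bimod_cat A) (x : hom X (bcar Y)) :
  hom (free_bimod X) Y := right_free_lift _ _ (free_lact_lift x).

Lemma after_free_lift (X : M) (Y Y' : bimod_cat A) (f : hom Y Y')
    (x : hom X (bcar Y)) :
  f \after free_lift x = free_lift (bmor f \after x).
Proof.
apply: bimod_hom_eq => /=.
by rewrite afterA bmor_r -afterA -omMl afterA bmor_l -afterA -omMr.
Qed.

(** The long composite is the unit x |-> (1 (x) x) (x) 1 of the free-forgetful adjunction. For [x]
    the identity, this splits [free_counit] in the base category. *)
Lemma free_lift_split (X : M) (Y : bimod_cat A) (x : hom X (bcar Y)) :
  bmor (free_lift x) \after ((((aone \om 1) \after lunitV X) \om aone) \after runitV X)
  = x.
Proof.
rewrite /= -(afterA (ract Y)) (afterA (_ \om 1)) -omM idmL.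
have -> : lact Y \after (1 \om x) \after ((aone \om 1) \after lunitV X) = x.
  rewrite -(afterA (lact Y)) (afterA (1 \om x)) -om_split' om_split !afterA.
  by rewrite lact1 lunit_nat -afterA lunitVK idmR.
by rewrite om_split' !afterA ract1 runit_nat -afterA runitVK idmR.
Qed.

Definition free_counit (P : bimod_cat A) : hom (free_bimod (bcar P)) P :=
  free_lift (idm (bcar P)).

Lemma projective_splitP (P : bimod_cat A) :
  E_projective (bimod_forget A) P <-> has_section (free_counit P).
Proof.
split=> [hP|[s es] X Y f [r er] g].
  by apply: hP; eexists; exact: free_lift_split.
(* The section [r] of [f] lives only in the base category. Extending [r \after bmor g] to the free
   bimodule makes it bilinear, and [s] brings the source back to [P]. *)
exists (free_lift (r \after bmor g) \after s).
rewrite afterA after_free_lift afterA [bmor f \after r]er idmL -[RHS]idmR -es afterA.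
by rewrite after_free_lift idmR.
Qed.
End FreeBimodule.

(** * Kernels of split epimorphisms *)

(** Chosen zero morphisms, absorbing for both composition and tensor product: all that the kernel
    arguments below ask of an additive structure. *)
Record zero_morphisms (M : monoidal_category) := ZeroMorphisms {
  zm : forall X Y : M, hom X Y;
  after_zm : forall (X Y Z : M) (f : hom Y Z), f \after zm X Y = zm X Z;
  zm_after : forall (X Y Z : M) (f : hom X Y), zm Y Z \after f = zm X Z;
  om_zm : forall (X X' Y Y' : M) (f : hom X X'), f \om zm Y Y' = zm _ _;
  zm_om : forall (X X' Y Y' : M) (f : hom X X'), zm Y Y' \om f = zm _ _
}.
Arguments zm {_} _ {_ _}.

(* The kernel [i] of a split epimorphism [f], presented as a split monomorphism:
   in a preadditive category, [i \after p = 1 - s \after f] for a section [s]. *)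
Record split_kernel (M : monoidal_category) (z : zero_morphisms M) (X Y N : M)
    (f : hom X Y) (i : hom N X) (p : hom X N) : Prop := SplitKernel {
  split_kernelK : p \after i = 1;
  split_kernel0 : f \after i = zm z;
  split_kernelP : forall (T : M) (t : hom T X),
    f \after t = zm z -> i \after (p \after t) = t
}.

Section SubBimodule.
Variables (M : monoidal_category) (A : algebra M) (X : bimod_cat A) (N : M).
Variables (i : hom N (bcar X)) (p : hom (bcar X) N).
Variables (nl : hom (A \ox N) N) (nr : hom (N \ox A) N).
Hypothesis pK : p \after i = 1.
Hypothesis i_nl : i \after nl = lact X \after (1 \om i).
Hypothesis i_nr : i \after nr = ract X \after (i \om 1).

Let i_mono (T : M) (t t' : hom T N) : i \after t = i \after t' -> t = t'.
Proof. by move=> it; rewrite -[t]idmL -[t']idmL -pK -!afterA it. Qed.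

(** As [i] is a split monomorphism, each axiom may be checked after composing with [i], where it
    becomes the same axiom for [X]. *)
Definition sub_bimod : bimod_cat A.
Proof.
apply: (@Bimodule M A N nl nr); apply: i_mono.
- rewrite !afterA i_nl -!afterA (afterA (1 \om i)) -omMr i_nl omMr -om_split'.
  rewrite om_split -(om1 A A) -(afterA (1 \om lact X)) -assoc_nat !afterA lactA.
  by rewrite -!afterA.
- by rewrite afterA i_nl -afterA -om_split' om_split afterA lact1 lunit_nat.
- rewrite !afterA i_nr -!afterA (afterA (i \om 1)) -omMl i_nr omMl.
  rewrite !afterA ractA -!afterA; congr (_ \after _).
  by rewrite assoc_nat om1 !afterA -om_split -om_split'.
- by rewrite afterA i_nr -afterA -om_split om_split' afterA ract1 runit_nat.
- rewrite !afterA i_nr i_nl -!afterA -omMl (afterA (1 \om i)) -omMr i_nl i_nr.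
  by rewrite omMl omMr -(afterA (1 \om ract X)) -assoc_nat !afterA lractA.
Defined.

Definition sub_bimod_incl : hom sub_bimod X := @BimodHom M A sub_bimod X i i_nl i_nr.
End SubBimodule.

Section BimoduleKernels.
Variables (M : monoidal_category) (z : zero_morphisms M) (A : algebra M).

Definition zero_bimod_hom (X Y : bimod_cat A) : hom X Y.
Proof. by exists (zm z); rewrite zm_after ?om_zm ?zm_om after_zm. Defined.

Lemma zero_bimodP (Z : bimod_cat A) : idm (bcar Z) = zm z -> is_zero_obj Z.
Proof.
move=> Z0; split=> X; exists (zero_bimod_hom _ _); split=> // f _; apply: bimod_hom_eq.
  by rewrite /= -[RHS]idmL Z0 zm_after.
by rewrite /= -[RHS]idmR Z0 after_zm.
Qed.

(** A zero morphism factors through some zero object [W], whose only endomorphism is both the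
    identity and zero. Conversely, [Z] is the object to factor through. *)
Lemma is_zero_mor_bimod (Z X Y : bimod_cat A) (f : hom X Y) :
  idm (bcar Z) = zm z -> is_zero_mor f <-> bmor f = zm z.
Proof.
move=> Z0; split=> [[W [g [h [[_ hW] ->]]]]|f0].
  have [w [_ uw]] := hW W.
  have W0 : idm W = zero_bimod_hom W W by rewrite -(uw (idm W)) // -(uw (zero_bimod_hom _ _)).
  by rewrite -[g]idmR W0 /= after_zm zm_after.
exists Z, (zero_bimod_hom _ _), (zero_bimod_hom _ _); split; first exact: zero_bimodP.
by apply: bimod_hom_eq; rewrite /= f0 zm_after.
Qed.

(** The retraction [p] is a morphism of the base category only. Still, [p \after t] is bilinear when
    [f] kills [t]: composing it with the split monomorphism [i] gives back the bilinear [t]. *)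
Lemma split_kernel_bimod (Z X Y N : bimod_cat A) (f : hom X Y) (i : hom N X)
    (p : hom (bcar X) (bcar N)) :
  idm (bcar Z) = zm z -> split_kernel z (bmor f) (bmor i) p -> is_kernel f i.
Proof.
move=> Z0 [pK fi ker]; split=> [|T t]; first exact/(is_zero_mor_bimod _ Z0).
move/(is_zero_mor_bimod _ Z0) => ft.
have ipt := ker _ _ ft.
have tl : p \after bmor t \after lact T = lact N \after (1 \om (p \after bmor t)).
  rewrite -[RHS]idmL -pK -(afterA p (bmor i)) (afterA (bmor i)) bmor_l -(afterA (lact X)).
  by rewrite -omMr ipt -afterA bmor_l.
have tr : p \after bmor t \after ract T = ract N \after ((p \after bmor t) \om 1).
  rewrite -[RHS]idmL -pK -(afterA p (bmor i)) (afterA (bmor i)) bmor_r -(afterA (ract X)).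
  by rewrite -omMl ipt -afterA bmor_r.
exists (BimodHom tl tr); split; first exact: bimod_hom_eq.
move=> w iw; apply: bimod_hom_eq => /=.
by rewrite -iw /= afterA pK idmL.
Qed.

Section KernelBimodule.
Variables (X Y : bimod_cat A) (f : hom X Y) (N : M).
Variables (i : hom N (bcar X)) (p : hom (bcar X) N).
Hypothesis ker : split_kernel z (bmor f) i p.

(** Since [f] is bilinear, it kills the action of [A] on the kernel, and [i \after p] fixes whatever
    [f] kills. Hence the kernel is stable under the actions of [X]. *)
Let i_nl : i \after (p \after (lact X \after (1 \om i))) = lact X \after (1 \om i).
Proof.
apply: (split_kernelP ker).
by rewrite afterA bmor_l -afterA -omMr (split_kernel0 ker) om_zm after_zm.
Qed.

Let i_nr : i \after (p \after (ract X \after (i \om 1))) = ract X \after (i \om 1).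
Proof.
apply: (split_kernelP ker).
by rewrite afterA bmor_r -afterA -omMl (split_kernel0 ker) zm_om after_zm.
Qed.

Definition kernel_bimod : bimod_cat A := sub_bimod (split_kernelK ker) i_nl i_nr.
Definition kernel_bimod_incl : hom kernel_bimod X :=
  sub_bimod_incl (split_kernelK ker) i_nl i_nr.
End KernelBimodule.
End BimoduleKernels.

(** * The forgetful functor on structured objects *)

Section Compare.
Variables (N : monoidal_category) (S : structured N).
Let M := smonoidal S.
Let U : monoidal_functor M N := sforget S.
Variable A : algebra M.
Let A' : algebra N := img_alg U A.
Let F : functor (bimod_cat A) (bimod_cat A') := img_functor U A.

(** The structure morphisms of [sforget] are identities, but composing with them is removed by
    rewriting and not by conversion. Hence the comparison morphisms below, all carried by
    identities. *)
Lemma himg_forget (X Y Z : M) (f : hom (X \ox Y) Z) : himg U f = smap f.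
Proof. exact: idmR. Qed.

Let img_amul : @amul N A' = smap (@amul M A) := himg_forget amul.

Definition free_compare (X : M) : hom (F (free_bimod A X)) (free_bimod A' (U X)).
Proof.
by apply: (@BimodHom N A' (F (free_bimod A X)) (free_bimod A' (U X))
    (idm (bcar (free_bimod A' (U X)))));
  rewrite idmL om1 idmR /= /free_lact ?himg_forget ?img_amul.
Defined.

Definition sq_compare : hom (F (sq_bimod A)) (sq_bimod A').
Proof.
by apply: (@BimodHom N A' (F (sq_bimod A)) (sq_bimod A') (idm (bcar (sq_bimod A'))));
  rewrite idmL om1 idmR /= !himg_forget.
Defined.

Definition sq_compareV : hom (sq_bimod A') (F (sq_bimod A)).
Proof.
by apply: (@BimodHom N A' (sq_bimod A') (F (sq_bimod A)) (idm (bcar (F (sq_bimod A)))));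
  rewrite idmL om1 idmR /= !himg_forget.
Defined.

Lemma free_counit_compare (P : bimod_cat A) :
  free_counit (F P) \after free_compare (bcar P) = fmor F (free_counit P).
Proof.
by apply: bimod_hom_eq; rewrite /= idmR !himg_forget.
Qed.

Lemma mul_sq_compare : mul_bimod A' \after sq_compare = fmor F (mul_bimod A).
Proof. by apply: bimod_hom_eq; rewrite /= idmR himg_forget. Qed.

Lemma mul_sq_compareV : fmor F (mul_bimod A) \after sq_compareV = mul_bimod A'.
Proof. by apply: bimod_hom_eq; rewrite /= idmR himg_forget. Qed.

Lemma forget_projective (P : bimod_cat A) :
  E_projective (bimod_forget A) P -> E_projective (bimod_forget A') (F P).
Proof.
move=> /projective_splitP /(has_section_fmor F)[t et]; apply/projective_splitP.
by exists (free_compare _ \after t); rewrite afterA free_counit_compare.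
Qed.

(** A section of [f] in the base category is sent by [U] to a section of [fmor F f], so [fmor F g]
    factors through [fmor F f]; separability brings the factorization back. *)
Lemma separable_projective (P : bimod_cat A) : separable_functor F ->
  E_projective (bimod_forget A') (F P) -> E_projective (bimod_forget A) P.
Proof.
move=> sepF hP X Y f hf g; apply: (separable_lift sepF); apply: hP.
exact: (has_section_fmor U hf).
Qed.

Lemma separable_forget : separable_algebra A -> separable_algebra A'.
Proof.
move=> /(has_section_fmor F)[t et].
by exists (sq_compare \after t); rewrite afterA mul_sq_compare.
Qed.

Lemma separable_reflect :
  separable_functor F -> separable_algebra A' -> separable_algebra A.
Proof.
(* A section is a factorization of the identity through the multiplication. *)
move=> sepF [t et]; apply: (separable_lift sepF).
by exists (sq_compareV \after t); rewrite afterA mul_sq_compareV et; apply: bimod_hom_eq.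
Qed.
End Compare.

(** * Kernels of the multiplication and formal smoothness *)

Section CompareKernels.
Variables (N : monoidal_category) (S : structured N).
Let M := smonoidal S.
Let U : monoidal_functor M N := sforget S.
Variables (zM : zero_morphisms M) (zN : zero_morphisms N).
Hypothesis smap_zm : forall X Y : M, smap (zm zM : hom X Y) = zm zN.
(** Split epimorphisms have split kernels that the forgetful functor preserves; [comod_split_kernel]
    establishes this for comodules. *)
Hypothesis split_kernels : forall (X Y : M) (f : hom X Y), has_section f ->
  exists (T : M) (i : hom T X) (p : hom X T),
    split_kernel zM f i p /\ split_kernel zN (smap f) (smap i) (smap p).
Variable A : algebra M.
Let A' : algebra N := img_alg U A.
Let F : functor (bimod_cat A) (bimod_cat A') := img_functor U A.

(** A zero bimodule is obtained as the kernel of the identity of the regular bimodule: there [i] is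
    zero, hence so is [p \after i = 1]. *)
Lemma null_bimod : exists Z : bimod_cat A, idm (bcar Z) = zm zM.
Proof.
have [|T [i [p [ker _]]]] := split_kernels (f := idm (acar A)).
  by exists (idm _); exact: idmL.
pose f : hom (reg_bimod A) (reg_bimod A) := idm _.
have kerf : split_kernel zM (bmor f) i p by [].
have i0 : i = zm zM by rewrite -[LHS]idmL; exact: (split_kernel0 ker).
have T0 : idm T = zm zM by rewrite -(split_kernelK ker) i0 after_zm.
by exists (kernel_bimod kerf).
Qed.

Lemma mul_split : has_section (bmor (mul_bimod A)).
Proof.
exists ((1 \om aone) \after runitV A).
by rewrite afterA amulr1 runitVK.
Qed.

Lemma mul_kernel : exists (W : bimod_cat A) (i : hom W (sq_bimod A)),
  is_kernel (mul_bimod A) i /\ is_kernel (mul_bimod A') (sq_compare A \after fmor F i).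
Proof.
have [Z Z0] := null_bimod.
have [T [i [p [ker ker']]]] := split_kernels mul_split.
exists (kernel_bimod ker), (kernel_bimod_incl ker); split.
  exact: (split_kernel_bimod (f := mul_bimod A) (i := kernel_bimod_incl ker) Z0 ker).
(* Kernels of bimodules over [A'] require a zero object there as well; [F Z] is one. *)
have FZ0 : idm (bcar (F Z)) = zm zN.
  by rewrite -(smap_zm (bcar Z) (bcar Z)) -Z0.
apply: (@split_kernel_bimod N zN A' (F Z) (sq_bimod A') (reg_bimod A')
  (F (kernel_bimod ker)) _ _ (smap p) FZ0).
have -> : bmor (mul_bimod A') = smap (bmor (mul_bimod A)) by exact: himg_forget.
have -> // : bmor (sq_compare A \after fmor F (kernel_bimod_incl ker)) = smap i.
exact: idmL.
Qed.

Lemma formally_smooth_forget : formally_smooth A -> formally_smooth A'.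
Proof.
move=> [W [i [ker hW]]]; have [W0 [i0 [ker0 ker0']]] := mul_kernel.
have [t [t' [_ tt']]] := kernel_iso ker0 ker.
exists (F W0), (sq_compare A \after fmor F i0); split=> //.
by apply: forget_projective; exact: retract_projective tt' hW.
Qed.

(** The given kernel [W] over [A'] need not come from [A], but it is isomorphic to [F W0], to which
    projectivity passes before being reflected to [W0]. *)
Lemma formally_smooth_reflect :
  separable_functor F -> formally_smooth A' -> formally_smooth A.
Proof.
move=> sepF [W [i [ker hW]]]; have [W0 [i0 [ker0 ker0']]] := mul_kernel.
have [t [t' [_ tt']]] := kernel_iso ker0' ker.
exists W0, i0; split=> //.
by apply: (separable_projective sepF); exact: retract_projective tt' hW.
Qed.
End CompareKernels.

(** * Comodules *)

Section LinearKernel.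
Local Open Scope ring_scope.
Variables (K : fieldType) (V W : lmodType K) (f : {linear V -> W}).

Definition lker_pred : {pred V} := fun v => f v == 0.

Fact lker_submod : submod_closed lker_pred.
Proof.
split=> [|a u v /eqP fu /eqP fv]; first by rewrite unfold_in linear0.
by rewrite unfold_in linearP fu fv scaler0 addr0.
Qed.
HB.instance Definition _ := GRing.isSubmodClosed.Build K V lker_pred
  lker_submod.

Record lker := Lker { lker_val : V; _ : lker_val \in lker_pred }.
HB.instance Definition _ := [isSub for lker_val].
HB.instance Definition _ := [Choice of lker by <:].
HB.instance Definition _ := [SubChoice_isSubLmodule of lker by <:].

Lemma lker_val0 (x : lker) : f (val x) = 0.
Proof. by apply/eqP; exact: (valP x). Qed.

Definition lker_incl : {linear lker -> V} := (val : {linear lker -> V}).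
End LinearKernel.

Section VectZero.
Local Open Scope ring_scope.
Variable K : fieldType.

Lemma tmap0l (V V' W W' : lmodType K) (g : {linear W -> W'}) (t : tensor V W) :
  tmap (\0 : {linear V -> V'}) g t = 0.
Proof.
elim/tensor_ind: t => [v w|x y hx hy]; last by rewrite linearD hx hy addr0.
by rewrite tmapE /= -(scale0r (0 : V')) pureZl scale0r.
Qed.

Lemma tmap0r (V V' W W' : lmodType K) (g : {linear V -> V'}) (t : tensor V W) :
  tmap g (\0 : {linear W -> W'}) t = 0.
Proof.
elim/tensor_ind: t => [v w|x y hx hy]; last by rewrite linearD hx hy addr0.
by rewrite tmapE /= -(scale0r (0 : W')) pureZr scale0r.
Qed.

Lemma tmapBl (V V' W W' : lmodType K) (f f' : {linear V -> V'})
    (g : {linear W -> W'}) (t : tensor V W) :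
  tmap (f \- f' : {linear V -> V'}) g t = tmap f g t - tmap f' g t.
Proof.
elim/tensor_ind: t => [v w|x y hx hy].
  by rewrite !tmapE /= pureDl -scaleN1r pureZl scaleN1r.
by rewrite !linearD hx hy addrACA /= -opprD.
Qed.

Lemma tmapBr (V V' W W' : lmodType K) (f f' : {linear W -> W'})
    (g : {linear V -> V'}) (t : tensor V W) :
  tmap g (f \- f' : {linear W -> W'}) t = tmap g f t - tmap g f' t.
Proof.
elim/tensor_ind: t => [v w|x y hx hy].
  by rewrite !tmapE /= pureDr -scaleN1r pureZr scaleN1r.
by rewrite !linearD hx hy addrACA /= -opprD.
Qed.

Definition vect_zero : zero_morphisms (vect K).
Proof.
apply: (@ZeroMorphisms (vect K) (fun V W => (\0 : {linear V -> W}))).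
- by move=> V W X f; apply: linear_ext => v /=; rewrite linear0.
- by move=> V W X f; apply: linear_ext.
- by move=> V V' W W' f; apply: linear_ext; exact: tmap0r.
- by move=> V V' W W' f; apply: linear_ext; exact: tmap0l.
Defined.

(** The retraction is v |-> v - s (f v), which lands in the kernel because [s] is a section. The
    formula for [i \after p] serves to prove it colinear once [f] and [s] are. *)
Lemma vect_split_kernel (V W : vect K) (f : hom V W) (s : hom W V) :
  (f \after s = 1)%cat ->
  exists (N : vect K) (i : hom N V) (p : hom V N),
    split_kernel vect_zero f i p /\
    (i \after p)%cat = ((idfun : {linear V -> V}) \- (s \after f)%cat : {linear V -> V}).
Proof.
move: V W f s => V W f s fs.
have fsE w : f (s w) = w by exact: (congr1 (fun g : {linear W -> W} => g w) fs).
pose q (v : V) : V := v - s (f v).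
have qP v : q v \in lker_pred f by rewrite unfold_in linearB /= fsE subrr.
pose p (v : V) : lker f := Sub (q v) (qP v).
have pE v : val (p v) = q v by rewrite SubK.
have p_lin : linear p.
  move=> a u v; apply: val_inj; rewrite linearP !pE /q.
  by rewrite (linearP f) (linearP s) opprD addrACA scalerBr.
have ipE (x : lker f) : p (val x) = x.
  by apply: val_inj; rewrite pE /q lker_val0 linear0 subr0.
exists (lker f : lmodType K), (lker_incl f), (mk_linear p_lin); split; last first.
  by apply: linear_ext => v; exact: pE.
split.
- by apply: linear_ext => x; exact: ipE.
- by apply: linear_ext => x; exact: lker_val0.
- move=> T t ft; apply: linear_ext => x; apply: (etrans (pE (t x))).
  have ft0 : f (t x) = 0 by exact: (congr1 (fun g : {linear T -> W} => g x) ft).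
  by rewrite /q ft0 linear0 subr0.
Qed.
End VectZero.

(** * Splitting colinear idempotents *)

Section ComoduleRetract.
Local Open Scope ring_scope.
Variables (K : fieldType) (H : hopf_algebra K).
Implicit Types V N W X Y U : lmodType K.

Lemma tassoc_tmap V V' W W' X X' (f : {linear V -> V'}) (g : {linear W -> W'})
    (h : {linear X -> X'}) (t : tensor (tensor V W) X) :
  tassoc _ _ _ (tmap (tmap f g) h t) = tmap f (tmap g h) (tassoc _ _ _ t).
Proof.
elim/tensor_ind: t => [u x|? ? e1 e2]; last by rewrite !linearD e1 e2.
elim/tensor_ind: u => [v w|? ? e1 e2]; last by rewrite !(pureDl, linearD) e1 e2.
by rewrite !(tmapE, tassocE).
Qed.

Lemma tmap_square V V' V'' U W W' W'' Y (f' : {linear V' -> V''}) (f : {linear V -> V'})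
    (h' : {linear U -> V''}) (h : {linear V -> U})
    (g' : {linear W' -> W''}) (g : {linear W -> W'})
    (k' : {linear Y -> W''}) (k : {linear W -> Y}) (t : tensor V W) :
  (forall v, f' (f v) = h' (h v)) -> (forall w, g' (g w) = k' (k w)) ->
  tmap f' g' (tmap f g t) = tmap h' k' (tmap h k t).
Proof.
move=> fh gk; rewrite (@tmap_comp _ _ _ _ _ _ _ _ _ _ _ (h' \o h) (k' \o k)) //.
by rewrite [RHS](@tmap_comp _ _ _ _ _ _ _ _ _ _ _ (h' \o h) (k' \o k)).
Qed.

Section ColinearImage.
Variables (V N : lmodType K) (i : N -> V) (p : {linear V -> N}).
Hypothesis pK : forall n, p (i n) = n.

Section Right.
Variables (r : {linear V -> tensor V H}) (r' : {linear N -> tensor N H}).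
Hypothesis pr : right_colinear r r' p.

(** Here [i] just witnesses that [p] is onto. At a point [p v], both sides of the axiom are images,
    by colinearity of [p], of the two sides at [v]. The other coaction axioms descend likewise. *)
Lemma right_coassoc_image : right_coassoc r -> right_coassoc r'.
Proof.
move=> rA n; rewrite -(pK n); move: (i n) => v; rewrite pr.
rewrite (@tmap_square _ _ _ _ _ _ _ _ _ _ (tmap p idfun) r _ _ idfun idfun) //.
rewrite tassoc_tmap rA; apply: tmap_square => // h.
by rewrite [RHS]/= tmap_id.
Qed.

Lemma right_counit_image : right_counit r -> right_counit r'.
Proof.
move=> rU n; rewrite -(pK n) -[in RHS](rU (i n)) pr; move: (r _) => t.
elim/tensor_ind: t => [v h|? ? e1 e2]; last by rewrite !linearD e1 e2.
by rewrite !tmapE !trunitE linearZ.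
Qed.
End Right.

Section Left.
Variables (l : {linear V -> tensor H V}) (l' : {linear N -> tensor H N}).
Hypothesis pl : left_colinear l l' p.

Lemma left_coassoc_image : left_coassoc l -> left_coassoc l'.
Proof.
move=> lA n; rewrite -(pK n); move: (i n) => v; rewrite pl.
rewrite (@tmap_square _ _ _ _ _ _ _ _ _ _ (tmap idfun idfun) Delta _ _ p idfun) //.
  rewrite tassoc_tmap lA; exact: tmap_square.
by move=> h; rewrite [RHS]tmap_id.
Qed.

Lemma left_counit_image : left_counit l -> left_counit l'.
Proof.
move=> lU n; rewrite -(pK n) -[in RHS](lU (i n)) pl; move: (l _) => t.
elim/tensor_ind: t => [h v|? ? e1 e2]; last by rewrite !linearD e1 e2.
by rewrite !tmapE !tlunitE linearZ.
Qed.
End Left.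

Lemma bicomod_compat_image (r : {linear V -> tensor V H}) (r' : {linear N -> tensor N H})
    (l : {linear V -> tensor H V}) (l' : {linear N -> tensor H N}) :
  right_colinear r r' p -> left_colinear l l' p ->
  (forall v, tassoc _ _ _ (tmap l idfun (r v)) = tmap idfun r (l v)) ->
  forall n, tassoc _ _ _ (tmap l' idfun (r' n)) = tmap idfun r' (l' n).
Proof.
move=> pr pl rl n; rewrite -(pK n); move: (i n) => v; rewrite pr pl.
rewrite (@tmap_square _ _ _ _ _ _ _ _ _ _ (tmap idfun p) l _ _ idfun idfun) //.
rewrite tassoc_tmap rl; exact: tmap_square.
Qed.
End ColinearImage.

Section Retract.
Variables (V N : lmodType K) (i : {linear N -> V}) (p : {linear V -> N}).
Hypothesis pK : cancel i p.

Definition right_retract (r : {linear V -> tensor V H}) : {linear N -> tensor N H} :=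
  tmap p idfun \o r \o i.
Definition left_retract (l : {linear V -> tensor H V}) : {linear N -> tensor H N} :=
  tmap idfun p \o l \o i.

(** Colinearity of the idempotent [i \o p] lets it cross [r]; then [pK] reduces i p i to i, and p i
    p to p. *)
Lemma right_retract_colinear r : right_colinear r r (i \o p) ->
  right_colinear (right_retract r) r i /\ right_colinear r (right_retract r) p.
Proof.
move=> ip; split=> v; rewrite /right_retract /=.
  rewrite (@tmap_comp _ _ _ _ _ _ _ _ _ _ _ (i \o p) idfun) // -ip /=.
  by rewrite pK.
rewrite (ip v : r (i (p v)) = _); apply: tmap_comp => // w /=.
by rewrite pK.
Qed.

Lemma left_retract_colinear l : left_colinear l l (i \o p) ->
  left_colinear (left_retract l) l i /\ left_colinear l (left_retract l) p.
Proof.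
move=> ip; split=> v; rewrite /left_retract /=.
  rewrite (@tmap_comp _ _ _ _ _ _ _ _ _ _ _ idfun (i \o p)) // -ip /=.
  by rewrite pK.
rewrite (ip v : l (i (p v)) = _); apply: tmap_comp => // w /=.
by rewrite pK.
Qed.
End Retract.

Lemma comod_str_retract (s : comod_kind) (V N : vect K) (i : hom N V) (p : hom V N)
    (c : str (comod_str H s) V) :
  (p \after i = 1)%cat -> smor (comod_str H s) c c (i \after p)%cat ->
  exists c' : str (comod_str H s) N,
    smor (comod_str H s) c' c i /\ smor (comod_str H s) c c' p.
Proof.
move=> /vect_cancel pK; case: s c => c.
  move=> /(right_retract_colinear pK)[ri rp].
  by exists (RightComodule (right_coassoc_image pK rp (rhoA c))
    (right_counit_image pK rp (rhoU c))).
move=> [/(right_retract_colinear pK)[ri rp] /(left_retract_colinear pK)[li lp]].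
by exists (Bicomodule (right_coassoc_image pK rp (brightA c))
  (right_counit_image pK rp (brightU c)) (left_coassoc_image pK lp (bleftA c))
  (left_counit_image pK lp (bleftU c))
  (bicomod_compat_image pK rp lp (bicomod_compat c))).
Qed.

Lemma comod_str_zero (s : comod_kind) (V W : vect K) (c : str (comod_str H s) V)
    (d : str (comod_str H s) W) : smor (comod_str H s) c d (zm (vect_zero K)).
Proof.
by case: s c d => c d; do ?split; move=> v /=; rewrite linear0 ?tmap0l ?tmap0r.
Qed.

Lemma comod_str_sub (s : comod_kind) (V W : lmodType K) (c : str (comod_str H s) V)
    (d : str (comod_str H s) W) (f g : {linear V -> W}) :
  smor (comod_str H s) c d f -> smor (comod_str H s) c d g ->
  smor (comod_str H s) c d (f \- g : {linear V -> W}).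
Proof.
case: s c d => c d /= => [fr gr v|[fr fl] [gr gl]].
  by rewrite /= linearB fr gr tmapBl.
by split=> v; rewrite /= linearB ?fr ?gr ?fl ?gl ?tmapBl ?tmapBr.
Qed.
End ComoduleRetract.

(** * Split kernels of comodules *)

Section ForgetfulFunctor.
Variables (K : fieldType) (H : hopf_algebra K) (s : comod_kind).
Let M := comod H s.
Let U : monoidal_functor M (vect K) := comod_forget H s.

Definition comod_zero : zero_morphisms M.
Proof.
apply: (@ZeroMorphisms M (fun X Y => SHom (comod_str_zero (sstr X) (sstr Y))));
  move=> *; apply: shom_eq; [exact: after_zm | exact: zm_after | exact: om_zm | exact: zm_om].
Defined.

Lemma comod_split_kernel (X Y : M) (f : hom X Y) : has_section f ->
  exists (N : M) (i : hom N X) (p : hom X N),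
    split_kernel comod_zero f i p /\
    split_kernel (vect_zero K) (fmor U f) (fmor U i) (fmor U p).
Proof.
case=> t ft; have ft' : fmor U f \after fmor U t = 1 by rewrite -fmorM ft fmor1.
have [N [i [p [ker ip]]]] := vect_split_kernel ft'.
(* The section [t] is taken among comodules, so the idempotent [1 - t \after f] is colinear and its
   image [N] inherits a coaction from [X]. *)
have sip : smor (comod_str H s) (sstr X) (sstr X) (i \after p).
  rewrite ip; apply: comod_str_sub; first exact: smapP (idm X).
  exact: smapP (t \after f).
have [c [ci cp]] := comod_str_retract (split_kernelK ker) sip.
exists (SObj c), (@SHom _ _ (SObj c) X i ci), (@SHom _ _ X (SObj c) p cp).
split=> //; split; try apply: shom_eq; case: ker => //.
by move=> _ _ ker T u /(congr1 (@smap _ _ _ _)) fu; apply: shom_eq; exact: ker.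
Qed.

End ForgetfulFunctor.

Theorem theorem2p12 (K : fieldType) (H : hopf_algebra K) (s : comod_kind)
    (A : algebra (comod H s)) :
  let U : monoidal_functor (comod H s) (vect K) := comod_forget H s in
  let A' : algebra (vect K) := img_alg U A in
  let F : functor (bimod_cat A) (bimod_cat A') := img_functor U A in
  (forall P : bimod_cat A,
     (E_projective (bimod_forget A) P -> E_projective (bimod_forget A') (F P))
     /\ (separable_functor F ->
         E_projective (bimod_forget A') (F P) -> E_projective (bimod_forget A) P))
  /\ ((separable_algebra A -> separable_algebra A')
      /\ (separable_functor F -> separable_algebra A' -> separable_algebra A))
  /\ ((formally_smooth A -> formally_smooth A')
      /\ (separable_functor F -> formally_smooth A' -> formally_smooth A)).
Proof.
move=> U A' F; split=> [P|].
  by split; [exact: forget_projective | exact: separable_projective].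
split; first by split; [exact: separable_forget | exact: separable_reflect].
have zU (X Y : comod H s) : smap (zm (comod_zero H s) : hom X Y) = zm (vect_zero K) by [].
split; first exact: (formally_smooth_forget zU (@comod_split_kernel K H s)).
exact: (formally_smooth_reflect zU (@comod_split_kernel K H s)).
Qed.
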